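(* Fix $(z,z')$ in the principal or complementary series. As $\xi\to1$ (with $0<\xi<1$), the projection operators $\mathrm{Proj}_+(D_{z,z',\xi})$ strongly converge (i.e. converge in the strong operator topology on $\ell^2(\mathbb{Z}')$) to the projection operator $\mathrm{Proj}_+(D^{\mathrm{gamma}}_{z,z'})$.
   Context: $\mathbb{Z}'=\mathbb{Z}+\tfrac12$ is the lattice of half-integers. $\ell^2_0(\mathbb{Z}')\subset\ell^2(\mathbb{Z}')$ is the dense subspace of finitely supported functions. $(z,z')$ belongs to the principal series if $z,z'\in\mathbb{C}$ are complex conjugate and nonreal; it belongs to the complementary series if $z,z'$ are real and both lie in one and the same open interval $(m,m+1)$ with $m\in\mathbb{Z}$. In both cases $(z+k)(z'+k)>0$ for all $k\in\mathbb{Z}$. For $0<\xi<1$, the difference operators $\mathcal{D}_{z,z',\xi}$ and $\mathcal{D}^{\mathrm{gamma}}_{z,z'}$ act on functions $f$ on $\mathbb{Z}'$ by $$\mathcal{D}_{z,z',\xi}f(x)=\sqrt{\xi(z+x+\tfrac12)(z'+x+\tfrac12)}\,f(x+1)-(x+\xi(z+z'+x))f(x)+\sqrt{\xi(z+x-\tfrac12)(z'+x-\tfrac12)}\,f(x-1),$$ $$\mathcal{D}^{\mathrm{gamma}}_{z,z'}f(x)=\sqrt{(z+x+\tfrac12)(z'+x+\tfrac12)}\,f(x+1)-(z+z'+2x)f(x)+\sqrt{(z+x-\tfrac12)(z'+x-\tfrac12)}\,f(x-1),$$ with positive square roots. Considered as symmetric operators in $\ell^2(\mathbb{Z}')$ with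 domain $\ell^2_0(\mathbb{Z}')$, both are essentially selfadjoint; $D_{z,z',\xi}$ and $D^{\mathrm{gamma}}_{z,z'}$ denote their closures. Zero is not an eigenvalue of either operator. For a selfadjoint operator $A$ for which $0$ is not a point of the discrete spectrum (not an eigenvalue), $\mathrm{Proj}_+(A)$ denotes the spectral projection of $A$ corresponding to the positive part $(0,+\infty)$ of its spectrum. *)

(* Defs.v *)
From HB Require Import structures.
From mathcomp Require Export all_boot all_order all_algebra.
From mathcomp Require Export all_classical all_reals all_analysis.
From mathcomp Require Export complex.

Set Implicit Arguments.
Unset Strict Implicit.
Unset Printing Implicit Defensive.

Export Order.TTheory GRing.Theory Num.Theory.
Export numFieldNormedType.Exports.

Local Open Scope classical_set_scope.
Local Open Scope complex_scope.
Local Open Scope ring_scope.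

(* The lattice Z' = Z + 1/2 is parametrized by [int]: the integer [n] stands
   for the half-integer n + 1/2, so a function on Z' is an [int -> R[i]]. *)

Definition half (R : realType) (n : int) : R[i] := n%:~R + 2^-1.

(* The sum over Z of an absolutely summable real family; only used where
   absolute summability holds. *)
Definition sumZ (R : realType) (a : int -> R) : R :=
  fine (\esum_(n in [set: int]) (Num.max (a n) 0)%:E) -
  fine (\esum_(n in [set: int]) (Num.max (- a n) 0)%:E).

Definition ell2 (R : realType) (f : int -> R[i]) : Prop :=
  (\esum_(n in [set: int]) (ComplexField.Normc.normc (f n) ^+ 2)%:E < +oo)%E.

Definition dot (R : realType) (f g : int -> R[i]) : R[i] :=
  sumZ (fun n => complex.Re (f n * conjc (g n))) +i*
  sumZ (fun n => complex.Im (f n * conjc (g n))).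

Definition ell2_norm (R : realType) (f : int -> R[i]) : R :=
  Num.sqrt
    (fine (\esum_(n in [set: int]) (ComplexField.Normc.normc (f n) ^+ 2)%:E)).

Definition finsupp (R : realType) (f : int -> R[i]) : Prop :=
  finite_set [set n | f n != 0].

(* An unbounded operator on l^2(Z') is represented by its graph. *)
Definition op_graph (R : realType) := set ((int -> R[i]) * (int -> R[i])).

(* The closure in l^2(Z') of the operator [D] with domain the finitely
   supported functions. *)
Definition op_closure (R : realType) (D : (int -> R[i]) -> (int -> R[i])) :
    op_graph R :=
  [set fg | ell2 fg.1 /\ ell2 fg.2 /\
    forall e : R, 0 < e -> exists h : int -> R[i], finsupp h /\
      ell2_norm (fun n => fg.1 n - h n) < e /\
      ell2_norm (fun n => fg.2 n - D h n) < e].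

Definition is_orthogonal_projection (R : realType)
    (P : (int -> R[i]) -> (int -> R[i])) : Prop :=
  [/\ forall f, ell2 f -> ell2 (P f),
      forall (a : R[i]) f g, ell2 f -> ell2 g ->
        P (fun n => a * f n + g n) = (fun n => a * P f n + P g n),
      forall f, ell2 f -> P (P f) = P f
    & forall f g, ell2 f -> ell2 g -> dot (P f) g = dot f (P g)].

(* Borel projection-valued measures on the real line; the values outside
   l^2(Z') are irrelevant. *)
Definition is_pvm (R : realType)
    (E : set (measurableTypeR R) -> (int -> R[i]) -> (int -> R[i])) : Prop :=
  [/\ forall B, measurable B -> is_orthogonal_projection (E B),
      forall f, ell2 f -> E set0 f = (fun=> 0) /\ E setT f = f,
      forall A B f, measurable A -> measurable B -> ell2 f ->
        E (A `&` B) f = E A (E B f)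
    & forall (B : (set (measurableTypeR R))^nat) f,
        (forall k, measurable (B k)) -> trivIset setT B -> ell2 f ->
        ell2_norm (fun n => E (\bigcup_k B k) f n - \sum_(k < N) E (B k) f n)
          @[N --> \oo] --> (0 : R)].

Definition spectral_measure (R : realType)
    (E : set (measurableTypeR R) -> (int -> R[i]) -> (int -> R[i]))
    (f : int -> R[i]) (B : set (measurableTypeR R)) : \bar R :=
  (complex.Re (dot (E B f) f))%:E.

(* A = \int x dE(x), including the equality of domains.  The identity
   <A f, f> = \int x d<E(x) f, f> on the domain determines A by polarization. *)
Definition is_spectral_resolution (R : realType) (A : op_graph R)
    (E : set (measurableTypeR R) -> (int -> R[i]) -> (int -> R[i])) : Prop :=
  [/\ is_pvm E,
      forall f, ell2 f -> ((exists g, A (f, g)) <->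
        (\int[spectral_measure E f]_x (x ^+ 2)%:E < +oo)%E)
    & forall f g, A (f, g) ->
        dot g f = (fine (\int[spectral_measure E f]_x x%:E)%E)%:C].

(* [P] is Proj_+(A), the spectral projection of A for (0, +oo).  Having a
   spectral resolution forces A to be selfadjoint. *)
Definition is_Proj_plus (R : realType) (A : op_graph R)
    (P : (int -> R[i]) -> (int -> R[i])) : Prop :=
  exists2 E, is_spectral_resolution A E &
    forall f, ell2 f -> P f = E `]0, +oo[%classic f.

Definition strong_cvg (R : realType) (F : set_system R)
    (P : R -> (int -> R[i]) -> (int -> R[i]))
    (Q : (int -> R[i]) -> (int -> R[i])) : Prop :=
  forall f, ell2 f ->
    ell2_norm (fun n => P xi f n - Q f n) @[xi --> F] --> (0 : R).

Definition principal_series (R : realType) (z z' : R[i]) : Prop :=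
  z' = conjc z /\ complex.Im z != 0.

Definition complementary_series (R : realType) (z z' : R[i]) : Prop :=
  exists a b : R, z = a%:C /\ z' = b%:C /\
    exists m : int, (m%:~R < a < m%:~R + 1) && (m%:~R < b < m%:~R + 1).

(* The radicands below are positive for principal or complementary (z, z'),
   and [sqrtC] is then the positive square root. *)
Definition hypergeom_op (R : realType) (z z' : R[i]) (xi : R)
    (f : int -> R[i]) (n : int) : R[i] :=
  let x : R[i] := half R n in
  sqrtC (xi%:C * (z + x + 2^-1) * (z' + x + 2^-1)) * f (n + 1)
  - (x + xi%:C * (z + z' + x)) * f n
  + sqrtC (xi%:C * (z + x - 2^-1) * (z' + x - 2^-1)) * f (n - 1).

Definition gamma_op (R : realType) (z z' : R[i])
    (f : int -> R[i]) (n : int) : R[i] :=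
  let x : R[i] := half R n in
  sqrtC ((z + x + 2^-1) * (z' + x + 2^-1)) * f (n + 1)
  - (z + z' + 2 * x) * f n
  + sqrtC ((z + x - 2^-1) * (z' + x - 2^-1)) * f (n - 1).

(* Main.v *)
Require Import Defs.
From HB Require Import structures.
From mathcomp Require Import measurable_realfun ring lra.

(**
Let D be the limit operator and D_xi the prelimit ones, with spectral
projections E and E_xi.  On finitely supported w one has D_xi w -> D w, and
these w form a core of D.  If u lies in the range of E(]x, y]) with 0 < x, then
|D u - x u| <= (y - x) |u|.  Approximate u by a finitely supported w: then
D_xi w is close to x w for xi near 1, and pairing with Q w, where
Q := E_xi(]-oo, 0]) and <D_xi w, Q w> <= 0, yields
limsup |Q u| <= (y - x) / x * |u|.  Cutting ]x, y] into K pieces improves the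
bound by a factor 1 / sqrt K, so Q u -> 0; such u are dense in the range of
E(]0, +oo[).  Negative spectrum is symmetric, and E({0}) = 0 because D has no
kernel.

For the kernel: with a_n^2 = (z + n + 1)(z' + n + 1) the equation D f = 0 has
the exact solution phi with phi_(n+1) / phi_n = (z + n + 1) / a_n; exchanging
z and z' if necessary, |phi| is bounded below at +oo.  For square summable f the
Wronskian of f and 1 / phi vanishes, so that
a_n f_(n+1) = (z' + n + 1) f_n.  Then (n + 1) |f_n|^2 is nondecreasing, which
contradicts square summability unless f = 0.
*)

Set Implicit Arguments.
Unset Strict Implicit.
Unset Printing Implicit Defensive.

Local Open Scope classical_set_scope.
Local Open Scope complex_scope.
Local Open Scope ring_scope.

(** * Absolutely summable families and the Hilbert space *)

Section Sums.
Variable R : realType.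
Implicit Types (a b p q : int -> R).

Definition psum a : \bar R := (\esum_(n in [set: int]) (a n)%:E)%E.

Definition summ a : Prop := (psum (fun n => `|a n|%R) < +oo)%E.

Lemma psum_ge0 a : (forall n, 0 <= a n) -> (0 <= psum a)%E.
Proof. by move=> a0; apply: esum_ge0 => n _; rewrite lee_fin. Qed.

Lemma le_psum a b : (forall n, a n <= b n) -> (psum a <= psum b)%E.
Proof. by move=> ab; apply: le_esum => n _; rewrite lee_fin. Qed.

Lemma psumD a b : (forall n, 0 <= a n) -> (forall n, 0 <= b n) ->
  psum (fun n => a n + b n) = (psum a + psum b)%E.
Proof.
by move=> a0 b0; rewrite -esumD //= => n _; rewrite lee_fin.
Qed.

Lemma psumZ_le k a : 0 <= k -> (forall n, 0 <= a n) ->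
  (psum (fun n => (k * a n)%R) <= k%:E * psum a)%E.
Proof.
move=> k0 a0; apply: ge_ereal_sup => _ [X [finX _]] <-.
under eq_fsbigr do rewrite EFinM.
rewrite -ge0_mule_fsumr; last by move=> n; rewrite lee_fin.
by apply: lee_wpmul2l; [rewrite lee_fin | apply: esum_ge; exists X].
Qed.

(** For [k > 0] the reverse inequality is [psumZ_le] with the factor [k^-1], applied to the scaled
    family. For [k = 0] both sides vanish by the convention [0 * +oo = 0]. *)
Lemma psumZ k a : 0 <= k -> (forall n, 0 <= a n) ->
  psum (fun n => (k * a n)%R) = (k%:E * psum a)%E.
Proof.
rewrite le_eqVlt => /predU1P[<- a0|k0 a0].
  rewrite mul0e; rewrite /psum; under eq_esum do rewrite mul0r.
  by rewrite esum1.
apply/eqP; rewrite eq_le psumZ_le ?(ltW k0)//=.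
have H : (psum a <= k^-1%:E * psum (fun n => (k * a n)%R))%E.
  apply: le_trans (@psumZ_le k^-1%R (fun n => k * a n)%R _ _).
  - by apply: le_psum => n; rewrite mulKf ?gt_eqF.
  - by rewrite invr_ge0 ltW.
  - by move=> n; rewrite mulr_ge0// ltW.
apply: (@le_trans _ _ (k%:E * (k^-1%:E * psum (fun n => (k * a n)%R)))%E).
  by apply: lee_wpmul2l => //; rewrite lee_fin ltW.
by rewrite muleA -EFinM divff ?gt_eqF// mul1e.
Qed.

Lemma fin_psum a : (forall n, 0 <= a n) -> (psum a < +oo)%E -> psum a \is a fin_num.
Proof. by move=> a0 ?; rewrite ge0_fin_numE// psum_ge0. Qed.

Lemma le_summ a b : (forall n, `|a n| <= b n) -> (psum b < +oo)%E -> summ a.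
Proof. by move=> ab; apply: le_lt_trans; exact: le_psum. Qed.

Lemma psum_pos_fin a : summ a -> psum (fun n => Num.max (a n) 0) \is a fin_num.
Proof.
move=> sa; apply: fin_psum => [n|]; first by rewrite le_max lexx orbT.
apply: le_lt_trans sa; apply: le_psum => n.
by rewrite ge_max ler_norm normr_ge0.
Qed.

Lemma summN a : summ a -> summ (fun n => - a n).
Proof.
by apply: le_lt_trans; apply: le_psum => n; rewrite normrN.
Qed.

(** Any splitting into summable nonnegative families may replace the positive and negative parts of
    [a]: cross-adding gives the identity max(a, 0) + q = p + max(-a, 0), in which every sum is
    finite. *)
Lemma sumZ_sub a p q : (forall n, 0 <= p n) -> (forall n, 0 <= q n) ->
    (psum p < +oo)%E -> (psum q < +oo)%E -> (forall n, a n = p n - q n) ->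
  sumZ a = fine (psum p) - fine (psum q).
Proof.
move=> p0 q0 fp fq apq.
have sa : summ a.
  apply: (@le_summ _ (fun n => p n + q n)); last by rewrite psumD// lte_add_pinfty.
  move=> n; rewrite apq (le_trans (ler_normB _ _))//.
  by rewrite (ger0_norm (p0 n)) (ger0_norm (q0 n)).
have m0 b n : 0 <= Num.max (b n) 0 by rewrite le_max lexx orbT.
rewrite /sumZ -/(psum (fun n => Num.max (a n) 0)).
rewrite -/(psum (fun n => Num.max (- a n) 0)).
have f1 := psum_pos_fin sa; have f2 := psum_pos_fin (summN sa).
have f3 := fin_psum p0 fp; have f4 := fin_psum q0 fq.
suff : fine (psum (fun n => Num.max (a n) 0)) + fine (psum q) =
       fine (psum p) + fine (psum (fun n => Num.max (- a n) 0)) by lra.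
rewrite -!fineD// -!psumD//; last exact: (m0 (fun n => - a n)).
congr (fine (psum _)); apply/funext => n; rewrite apq.
case: (leP (p n - q n) 0) => h; case: (leP (- (p n - q n)) 0) => h'; lra.
Qed.

Lemma sumZ_ge0E a : (forall n, 0 <= a n) -> (psum a < +oo)%E ->
  sumZ a = fine (psum a).
Proof.
move=> a0 fa; rewrite (@sumZ_sub a a (fun=> 0))//.
- by rewrite {2}/psum esum1// subr0.
- by rewrite {1}/psum esum1// ltry.
- by move=> n; rewrite subr0.
Qed.

Lemma sumZD a b : summ a -> summ b ->
  sumZ (fun n => a n + b n) = sumZ a + sumZ b.
Proof.
move=> sa sb.
pose P c (n : int) : R := Num.max (c n) 0; pose N c (n : int) : R := Num.max (- c n) 0.
have P0 c n : 0 <= P c n by rewrite le_max lexx orbT.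
have N0 c n : 0 <= N c n by rewrite le_max lexx orbT.
have fin c : (forall n, 0 <= c n) -> psum c \is a fin_num -> (psum c < +oo)%E.
  by move=> c0; rewrite ge0_fin_numE// psum_ge0.
have fPa := psum_pos_fin sa; have fPb := psum_pos_fin sb.
have fNa := psum_pos_fin (summN sa); have fNb := psum_pos_fin (summN sb).
rewrite (@sumZ_sub _ (fun n => P a n + P b n) (fun n => N a n + N b n)).
- rewrite !psumD ?fineD// /sumZ /P /N /psum; lra.
- by move=> n; rewrite addr_ge0.
- by move=> n; rewrite addr_ge0.
- by rewrite psumD// lte_add_pinfty// fin.
- by rewrite psumD// lte_add_pinfty// fin.
- move=> n; rewrite /P /N.
  case: (leP (a n) 0) => h; case: (leP (- a n) 0) => h';
  case: (leP (b n) 0) => k; case: (leP (- b n) 0) => k'; lra.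
Qed.

Lemma sumZN a : sumZ (fun n => - a n) = - sumZ a.
Proof.
rewrite /sumZ opprB; congr (_ - _).
by congr (fine _); apply: eq_esum => n _; rewrite opprK.
Qed.

Lemma sumZZ k a : summ a -> sumZ (fun n => k * a n) = k * sumZ a.
Proof.
wlog k0 : k / 0 <= k => [wl sa|sa].
  have [k0|k0] := leP 0 k; first exact: wl.
  rewrite -[k]opprK mulNr -(wl (- k))// ?oppr_ge0 ?ltW// -sumZN.
  by congr sumZ; apply/funext => n; rewrite mulNr.
have m (c : int -> R) n : 0 <= Num.max (c n) 0 by rewrite le_max lexx orbT.
have E c : psum (fun n => Num.max (k * c n) 0) =
    (k%:E * psum (fun n => Num.max (c n) 0%R))%E.
  rewrite -psumZ//; congr psum; apply/funext => n.
  by rewrite maxr_pMr// mulr0.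
have := E (fun n => - a n); have := E a; rewrite /sumZ /psum => -> E2.
under [in X in _ - X]eq_esum do rewrite -mulrN.
rewrite E2 !fineM// ?mulrBr//.
  exact: (psum_pos_fin (summN sa)).
exact: psum_pos_fin.
Qed.

Lemma psum_mem_le a n : (forall n, 0 <= a n) -> ((a n)%:E <= psum a)%E.
Proof.
move=> a0; rewrite -(@esum_set1 R int n (fun n => (a n)%:E)) ?lee_fin//.
rewrite /psum [leRHS](esumID [set n])//; last by move=> ? _; rewrite lee_fin.
by rewrite setTI leeDl// esum_ge0// => ? _; rewrite lee_fin.
Qed.

End Sums.

(** * The Hilbert space of square summable functions and its real inner product *)

Section Hilbert.
Variable R : realType.
Local Notation C := R[i].
Implicit Types (f g h : int -> C).

Definition sqn (c : C) : R := ComplexField.Normc.normc c ^+ 2.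

Lemma sqnE (c : C) : sqn c = complex.Re c ^+ 2 + complex.Im c ^+ 2.
Proof. by case: c => a b; rewrite /sqn sqr_sqrtr// addr_ge0// sqr_ge0. Qed.

Lemma sqn_ge0 (c : C) : 0 <= sqn c. Proof. exact: sqr_ge0. Qed.

Definition rprod (c d : C) : R := complex.Re (c * conjc d).

Lemma rprodE c d : rprod c d =
  complex.Re c * complex.Re d + complex.Im c * complex.Im d.
Proof. by case: c d => [a b] [a' b']; rewrite /rprod /=; lra. Qed.

(** The real inner product underlying the Hermitian one. It suffices for norms and inequalities, and
    the imaginary part comes back through multiplication by ['i] ([rdot_i], [rdot_iC]). *)
Definition rdot f g : R := complex.Re (dot f g).

Lemma rdotE f g : rdot f g = sumZ (fun n => rprod (f n) (g n)).
Proof. by []. Qed.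

Lemma ell2D f g : ell2 f -> ell2 g -> ell2 (fun n => f n + g n).
Proof.
move=> lf lg; apply: (@le_lt_trans _ _ (psum (fun n => 2 * (sqn (f n) + sqn (g n))))).
  apply: le_psum => n; rewrite -/(sqn _) !sqnE.
  case: (f n) (g n) => [a b] [a' b'] /=.
  have := sqr_ge0 (a - a'); have := sqr_ge0 (b - b'); lra.
rewrite psumZ ?psumD//; last by move=> n; rewrite addr_ge0// sqn_ge0.
- have ff := fin_psum (fun n => sqn_ge0 (f n)) lf.
  have fg := fin_psum (fun n => sqn_ge0 (g n)) lg.
  by rewrite -(fineK ff) -(fineK fg) -EFinD -EFinM ltry.
- by move=> n; exact: sqn_ge0.
- by move=> n; exact: sqn_ge0.
Qed.

Lemma sqnM c d : sqn (c * d) = sqn c * sqn d.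
Proof. by rewrite /sqn ComplexField.Normc.normcM exprMn. Qed.

Lemma ell2Z c f : ell2 f -> ell2 (fun n => c * f n).
Proof.
move=> lf; apply: (@le_lt_trans _ _ (psum (fun n => sqn c * sqn (f n)))).
  by apply: le_psum => n; rewrite -/(sqn _) sqnM.
rewrite psumZ ?sqn_ge0//; last by move=> n; exact: sqn_ge0.
have ff := fin_psum (fun n => sqn_ge0 (f n)) lf.
by rewrite -(fineK ff) -EFinM ltry.
Qed.

Lemma ell2N f : ell2 f -> ell2 (fun n => - f n).
Proof.
move=> /(ell2Z (-1)); congr ell2.
by apply/funext => n; rewrite mulN1r.
Qed.

Lemma ell2B f g : ell2 f -> ell2 g -> ell2 (fun n => f n - g n).
Proof. by move=> lf lg; apply: ell2D => //; exact: ell2N. Qed.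

Lemma ell20 : ell2 (fun _ : int => 0 : C).
Proof.
rewrite /ell2 esum1 ?ltry// => n _.
by rewrite -/(sqn 0) sqnE /= expr0n addr0.
Qed.

Lemma summ_rprod f g : ell2 f -> ell2 g -> summ (fun n => rprod (f n) (g n)).
Proof.
move=> lf lg; apply: (@le_summ _ _ (fun n => sqn (f n) + sqn (g n))).
  move=> n; rewrite !sqnE rprodE.
  case: (f n) (g n) => [a b] [a' b'] /=.
  have := sqr_ge0 (a - a'); have := sqr_ge0 (b - b').
  have := sqr_ge0 (a + a'); have := sqr_ge0 (b + b').
  by rewrite ler_norml => ? ? ? ?; apply/andP; split; lra.
by rewrite psumD ?lte_add_pinfty// => n; exact: sqn_ge0.
Qed.

Lemma rdotC f g : rdot f g = rdot g f.
Proof. by rewrite !rdotE; congr sumZ; apply/funext => n; rewrite !rprodE; ring. Qed.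

Lemma rdotDl f g h : ell2 f -> ell2 g -> ell2 h ->
  rdot (fun n => f n + g n) h = rdot f h + rdot g h.
Proof.
move=> lf lg lh; rewrite !rdotE -sumZD; [|exact: summ_rprod|exact: summ_rprod].
congr sumZ; apply/funext => n; rewrite !rprodE.
by case: (f n) (g n) => [a b] [a' b'] /=; ring.
Qed.

Lemma rdotZl (k : R) f g : ell2 f -> ell2 g ->
  rdot (fun n => k%:C * f n) g = k * rdot f g.
Proof.
move=> lf lg; rewrite !rdotE -sumZZ; last exact: summ_rprod.
congr sumZ; apply/funext => n; rewrite !rprodE.
by case: (f n) => [a b] /=; ring.
Qed.

Lemma rdotNl f g : ell2 f -> ell2 g -> rdot (fun n => - f n) g = - rdot f g.
Proof.
move=> lf lg; have -> : (fun n => - f n) = (fun n => (-1)%:C * f n).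
  apply/funext => n; case: (f n) => a b.
  by apply/eqP; rewrite eq_complex /= !mul0r !mulN1r subr0 addr0 !eqxx.
by rewrite rdotZl// mulN1r.
Qed.

Lemma rdotBl f g h : ell2 f -> ell2 g -> ell2 h ->
  rdot (fun n => f n - g n) h = rdot f h - rdot g h.
Proof. by move=> lf lg lh; rewrite rdotDl ?rdotNl//; exact: ell2N. Qed.

Lemma rdotDr f g h : ell2 f -> ell2 g -> ell2 h ->
  rdot h (fun n => f n + g n) = rdot h f + rdot h g.
Proof. by move=> *; rewrite rdotC rdotDl// !(rdotC h). Qed.

Lemma rdotBr f g h : ell2 f -> ell2 g -> ell2 h ->
  rdot h (fun n => f n - g n) = rdot h f - rdot h g.
Proof. by move=> *; rewrite rdotC rdotBl// !(rdotC h). Qed.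

Lemma rdotZr (k : R) f g : ell2 f -> ell2 g ->
  rdot g (fun n => k%:C * f n) = k * rdot g f.
Proof. by move=> *; rewrite rdotC rdotZl// !(rdotC g). Qed.

Lemma rdot_ii f g : rdot (fun n => 'i * f n) (fun n => 'i * g n) = rdot f g.
Proof.
rewrite !rdotE; congr sumZ; apply/funext => n; rewrite !rprodE.
by case: (f n) (g n) => [a b] [a' b'] /=; ring.
Qed.

Lemma rdot_i f g : rdot f (fun n => 'i * g n) = complex.Im (dot f g).
Proof.
rewrite rdotE /dot /=; congr sumZ; apply/funext => n; rewrite !rprodE.
by case: (f n) (g n) => [a b] [a' b'] /=; ring.
Qed.

Lemma rdot_iC f g : rdot (fun n => 'i * f n) g = - complex.Im (dot f g).
Proof.
rewrite rdotE /dot /= -sumZN; congr sumZ; apply/funext => n; rewrite !rprodE.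
by case: (f n) (g n) => [a b] [a' b'] /=; ring.
Qed.

Local Notation nrm := (@ell2_norm R).

Lemma rdotff f : ell2 f -> rdot f f = nrm f ^+ 2.
Proof.
move=> lf; rewrite rdotE /ell2_norm sqr_sqrtr.
  rewrite (_ : (fun n => rprod _ _) = (fun n => sqn (f n))).
    by rewrite sumZ_ge0E// => n; exact: sqn_ge0.
  by apply/funext => n; rewrite rprodE sqnE; ring.
by rewrite fine_ge0// psum_ge0// => n; exact: sqn_ge0.
Qed.

Lemma nrm_ge0 f : 0 <= nrm f. Proof. exact: sqrtr_ge0. Qed.

(** Cauchy-Schwarz: expand the square of the norm of s f - t g and take s = |g|, t = |f|. That
    choice says nothing when a norm is zero, so these two cases come first. *)
Lemma rdot_le f g : ell2 f -> ell2 g -> rdot f g <= nrm f * nrm g.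
Proof.
move=> lf lg.
have pos (s t : R) : 0 <= s ^+ 2 * nrm f ^+ 2 - 2 * s * t * rdot f g + t ^+ 2 * nrm g ^+ 2.
  have l1 := ell2Z s%:C lf; have l2 := ell2Z t%:C lg.
  rewrite (_ : _ + _ = nrm (fun n => s%:C * f n - t%:C * g n) ^+ 2) ?sqr_ge0//.
  have l12 := ell2B l1 l2.
  rewrite -(rdotff l12) rdotBl// !rdotBr// !rdotZl// !rdotZr// (rdotC g f).
  by rewrite -(rdotff lf) -(rdotff lg); ring.
have [f0|f0] := eqVneq (nrm f) 0.
  rewrite f0 mul0r leNgt; apply/negP => d0.
  (* With |f| = 0 the quadratic form is |g|^2 - 2 s <f, g>; this [s] makes it equal to -1. *)
  have := pos ((nrm g ^+ 2 + 1) / (2 * rdot f g)) 1; rewrite f0.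
  rewrite expr0n /= mulr0 add0r !mulr1 expr1n mul1r.
  rewrite -mulrA [_ / _ * _]mulrC mulrA [2 * _]mulrC.
  by rewrite [_ * (_ / _)]mulrC mulrVK ?unitfE; lra.
have [g0|g0] := eqVneq (nrm g) 0.
  rewrite g0 mulr0 leNgt; apply/negP => d0.
  have := pos 1 ((nrm f ^+ 2 + 1) / (2 * rdot f g)); rewrite g0.
  rewrite expr0n /= mulr0 addr0 !mulr1 expr1n mul1r.
  rewrite [2 * _]mulrC -mulrA mulrVK ?unitfE; lra.
have fp : 0 < nrm f by rewrite lt_def f0 nrm_ge0.
have gp : 0 < nrm g by rewrite lt_def g0 nrm_ge0.
rewrite -subr_ge0 -(pmulr_rge0 _ (mulr_gt0 fp gp)).
have := pos (nrm g) (nrm f); lra.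
Qed.

Lemma nrmN f : nrm (fun n => - f n) = nrm f.
Proof.
rewrite /ell2_norm; congr (Num.sqrt (fine _)); apply: eq_esum => n _.
by rewrite -!/(sqn _) !sqnE; case: (f n) => a b /=; rewrite !sqrrN.
Qed.

Lemma nrmD f g : ell2 f -> ell2 g -> nrm (fun n => f n + g n) <= nrm f + nrm g.
Proof.
move=> lf lg; rewrite -(@ler_pXn2r _ 2)// ?nnegrE ?addr_ge0 ?nrm_ge0//.
have lfg := ell2D lf lg.
rewrite -(rdotff lfg) rdotDl// !rdotDr// (rdotC g f) !rdotff//.
have := rdot_le lf lg; lra.
Qed.

Lemma nrmB f g : ell2 f -> ell2 g -> nrm (fun n => f n - g n) <= nrm f + nrm g.
Proof.
by move=> lf lg; rewrite (le_trans (nrmD lf (ell2N lg)))// nrmN.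
Qed.

Lemma nrmBC f g : nrm (fun n => f n - g n) = nrm (fun n => g n - f n).
Proof. by rewrite -nrmN; under eq_fun do rewrite opprB. Qed.

Lemma nrmZ (k : R) f : ell2 f -> nrm (fun n => k%:C * f n) = `|k| * nrm f.
Proof.
move=> lf; have lkf := ell2Z k%:C lf.
apply/eqP; rewrite -(@eqrXn2 _ 2)// ?mulr_ge0 ?nrm_ge0//.
by rewrite -(rdotff lkf) rdotZl// rdotZr// (rdotff lf) exprMn real_normK ?num_real// mulrA.
Qed.

Lemma normc_le_nrm f n : ell2 f -> ComplexField.Normc.normc (f n) <= nrm f.
Proof.
move=> lf; rewrite -(@ler_pXn2r _ 2)// ?nnegrE ?nrm_ge0//; last first.
  by case: (f n) => a b; exact: sqrtr_ge0.
rewrite sqr_sqrtr; last by rewrite fine_ge0// psum_ge0// => m; exact: sqn_ge0.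
rewrite -lee_fin fineK; last by apply: fin_psum => // m; exact: sqn_ge0.
by apply: (@psum_mem_le _ (fun n => sqn (f n))) => m; exact: sqn_ge0.
Qed.

Lemma nrm_eq0 f : ell2 f -> nrm f = 0 -> f = (fun=> 0).
Proof.
move=> lf f0; apply/funext => n; apply: ComplexField.Normc.eq0_normc.
apply/eqP; rewrite eq_le -{1}f0 normc_le_nrm//=.
by case: (f n) => a b; exact: sqrtr_ge0.
Qed.

Lemma nrm0 : nrm (fun _ => 0 : C) = 0.
Proof.
apply/eqP; rewrite -sqrf_eq0 -(rdotff ell20).
rewrite rdotE sumZ_ge0E ?/psum ?esum1// => n; rewrite ?rprodE /=;
by rewrite ?mulr0 ?addr0.
Qed.

Lemma ell2_finsupp f : finsupp f -> ell2 f.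
Proof.
move=> ff; rewrite /ell2; set a := fun n => _.
have -> : \esum_(n in [set: int]) a n = \esum_(n in [set n | f n != 0]) a n.
  rewrite [RHS]esum_mkcond; apply: eq_esum => n _.
  case: ifPn => //; rewrite notin_setE /= => /negP; rewrite negbK => /eqP f0.
  by rewrite /a f0 -/(sqn 0) sqnE /= expr0n addr0.
rewrite esum_fset//; last by move=> n _; rewrite lee_fin sqn_ge0.
by rewrite fsumEFin// ltry.
Qed.

End Hilbert.

(** * Moments of Borel measures *)

Section SetFun.
Import HBNNSimple.

(** Integrals are defined for arbitrary set functions, and simple functions have measurable level
    sets. This lets the bare set function [spectral_measure] be exchanged for a genuine measure that
    agrees with it on measurable sets only. *)
Lemma eq_integral_set_fun d (X : measurableType d) (R : realType)
    (mu nu : set X -> \bar R) (D : set X) (phi : X -> \bar R) :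
  (forall B, measurable B -> mu B = nu B) ->
  (\int[mu]_(x in D) phi x = \int[nu]_(x in D) phi x)%E.
Proof.
move=> munu; rewrite /integral.
have sint (h : {nnsfun X >-> R}) : sintegral mu h = sintegral nu h.
  by apply: eq_fsbigr => x _; rewrite munu.
by congr (ereal_sup _ - ereal_sup _)%E; apply: eq_imagel => h _; exact: sint.
Qed.

End SetFun.

Section IntegralBounds.
Variable R : realType.
Local Notation T := (measurableTypeR R).
Implicit Types mu nu : {measure set T -> \bar R}.

Definition second_moment mu := (\int[mu]_x (x ^+ 2)%:E)%E.
Definition first_moment mu := (\int[mu]_x x%:E)%E.

Lemma measurable_EFinid : measurable_fun [set: T] (fun x : T => (x : R)%:E).
Proof. by apply/measurable_EFinP; exact: measurable_id. Qed.

Lemma measurable_sqr : measurable_fun [set: T] (fun x : T => ((x : R) ^+ 2)%:E).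
Proof. by apply/measurable_EFinP; apply: measurable_funX; exact: measurable_id. Qed.

(** The integrand is dominated through |x| <= 1 + x^2. *)
Lemma integrable_first_moment mu : (mu setT < +oo)%E ->
  (second_moment mu < +oo)%E -> mu.-integrable setT (fun x : T => (x : R)%:E).
Proof.
move=> fmu smu.
have i1 : mu.-integrable setT (fun x : T => ((x : R) ^+ 2)%:E).
  apply/integrableP; split; first exact: measurable_sqr.
  apply: le_lt_trans smu; rewrite le_eqVlt; apply/orP; left; apply/eqP.
  by apply: eq_integral => x _; rewrite gee0_abs// lee_fin sqr_ge0.
have i2 : mu.-integrable setT (fun x : T => (1 : R)%:E).
  apply/integrableP; split; first exact: measurable_cst.
  under eq_integral do rewrite abse1.
  by rewrite integral_cst// mul1e.
apply: (le_integrable measurableT _ _ (integrableD measurableT i2 i1)).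
  exact: measurable_EFinid.
move=> x _; rewrite -[leRHS]/(`|1 + (x : R) ^+ 2|%:E) -[leLHS]/(`|x : R|%:E) lee_fin.
rewrite (ger0_norm (addr_ge0 ler01 (sqr_ge0 _))).
have := sqr_ge0 (x - 1 : R); have := sqr_ge0 (x + 1 : R).
rewrite ler_norml => ? ?; apply/andP; split; lra.
Qed.

Lemma integral_null mu (S : set T) (f : T -> \bar R) : measurable S ->
  mu S = 0%E -> (\int[mu]_(x in S) f x = 0)%E.
Proof.
move=> mS S0; rewrite (@eq_measure_integral _ _ _ _ mzero); last first.
  move=> A mA AS; apply/eqP; rewrite eq_le measure_ge0 andbT.
  by rewrite -[leRHS]S0 le_measure// inE.
exact: integral_measure_zero.
Qed.

Lemma full_measure mu (S : set T) : measurable S ->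
  mu (~` S) = 0%E -> mu S = mu setT.
Proof.
move=> mS S0; rewrite -[in RHS](setUv S) measureU ?setICr//; last exact: measurableC.
rewrite -[LHS]adde0; congr (_ + _)%E; exact: esym.
Qed.

Lemma first_moment_split mu (S : set T) : measurable S ->
  first_moment mu = (\int[mu]_(x in S) x%:E + \int[mu]_(x in ~` S) x%:E)%E.
Proof.
move=> mS; rewrite /first_moment -{1}(setUv S) integral_setU//.
- exact: measurableC.
- by apply/disj_setPS; rewrite setICr.
Qed.

(** Meant for spectral measures of two vectors in complementary spectral subspaces and of their sum:
    each half of the integral sees only one of the two measures. *)
Lemma first_moment_additive mu mu1 mu2 (S : set T) : measurable S ->
  (forall B, measurable B -> B `<=` S -> mu B = mu1 B) ->
  (forall B, measurable B -> B `<=` ~` S -> mu B = mu2 B) ->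
  mu1 (~` S) = 0%E -> mu2 S = 0%E ->
  first_moment mu = (first_moment mu1 + first_moment mu2)%E.
Proof.
move=> mS e1 e2 z1 z2; rewrite !(first_moment_split _ mS).
rewrite (integral_null _ mS z2) (integral_null _ (measurableC mS) z1) adde0 add0e.
by congr (_ + _)%E; apply: eq_measure_integral.
Qed.

Lemma first_moment_le mu (S : set T) (d : R) : measurable S ->
  (mu setT < +oo)%E -> (second_moment mu < +oo)%E -> mu (~` S) = 0%E ->
  (forall x, S x -> x <= d) -> fine (first_moment mu) <= d * fine (mu setT).
Proof.
move=> mS fmu smu S0 Sd.
have ix := integrable_first_moment fmu smu.
have fm : mu setT \is a fin_num by rewrite ge0_fin_numE.
have muS := full_measure mS S0.
have fx : first_moment mu \is a fin_num by exact: integrable_fin_num.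
rewrite -lee_fin fineK// EFinM fineK// (first_moment_split _ mS).
rewrite (integral_null _ (measurableC mS) S0) adde0 -muS.
rewrite -(integral_cst mu mS d%:E); apply: le_integral => //.
- exact: integrableS ix.
- apply/integrableP; split; first exact: measurable_cst.
  rewrite (eq_integral (cst `|d%:E|%E))// integral_cst// muS.
  by rewrite -(fineK fm) -EFinM ltry.
- by move=> x; rewrite inE lee_fin => /Sd.
Qed.

Lemma first_moment_ge mu (S : set T) (c : R) : measurable S ->
  (mu setT < +oo)%E -> (second_moment mu < +oo)%E -> mu (~` S) = 0%E ->
  (forall x, S x -> c <= x) -> c * fine (mu setT) <= fine (first_moment mu).
Proof.
move=> mS fmu smu S0 Sd.
have ix := integrable_first_moment fmu smu.
have fm : mu setT \is a fin_num by rewrite ge0_fin_numE.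
have muS := full_measure mS S0.
have fx : first_moment mu \is a fin_num by exact: integrable_fin_num.
rewrite -lee_fin fineK// EFinM fineK// (first_moment_split _ mS).
rewrite (integral_null _ (measurableC mS) S0) adde0 -muS.
rewrite -(integral_cst mu mS c%:E); apply: le_integral => //.
- apply/integrableP; split; first exact: measurable_cst.
  rewrite (eq_integral (cst `|c%:E|%E))// integral_cst// muS.
  by rewrite -(fineK fm) -EFinM ltry.
- exact: integrableS ix.
- by move=> x; rewrite inE lee_fin => /Sd.
Qed.

Lemma second_moment_bounded mu (S : set T) (M : R) : measurable S ->
  (mu setT < +oo)%E -> mu (~` S) = 0%E ->
  (forall x, S x -> x ^+ 2 <= M) -> (second_moment mu < +oo)%E.
Proof.
move=> mS fmu S0 SM; rewrite /second_moment -(setUv S) ge0_integral_setU//.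
- rewrite (integral_null _ (measurableC mS) S0) adde0.
  apply: (@le_lt_trans _ _ (\int[mu]_(x in S) (cst M%:E) x)%E).
    apply: ge0_le_integral => //.
    + by move=> x _; rewrite lee_fin sqr_ge0.
    + by apply: measurable_funS measurable_sqr.
  rewrite integral_cst//; have fS : mu S \is a fin_num.
    rewrite ge0_fin_numE//; apply: le_lt_trans fmu.
    by rewrite le_measure// inE.
  by rewrite -(fineK fS) -EFinM ltry.
- exact: measurableC.
- by rewrite setUv; exact: measurable_sqr.
- by move=> x _; rewrite lee_fin sqr_ge0.
- by apply/disj_setPS; rewrite setICr.
Qed.

Lemma le_second_moment mu nu :
  (forall B, measurable B -> (mu B <= nu B)%E) ->
  (second_moment mu <= second_moment nu)%E.
Proof.
move=> h; apply: ge0_le_measure_integral => //.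
  by move=> x; rewrite lee_fin sqr_ge0.
exact: measurable_sqr.
Qed.

End IntegralBounds.

(** * Projection-valued measures and spectral resolutions *)

Section Pvm.
Variable R : realType.
Local Notation C := R[i].
Local Notation T := (measurableTypeR R).
Local Notation nrm := (@ell2_norm R).
Variable E : set T -> (int -> C) -> (int -> C).
Hypothesis hE : is_pvm E.
Implicit Types (f g : int -> C) (S B : set T).

Lemma ell2_pvm S f : measurable S -> ell2 f -> ell2 (E S f).
Proof. by case: hE => + _ _ _ => /[apply] -[+ _ _ _]; exact. Qed.

Lemma pvm_lin S (c : C) f g : measurable S -> ell2 f -> ell2 g ->
  E S (fun n => c * f n + g n) = (fun n => c * E S f n + E S g n).
Proof. by case: hE => + _ _ _ => /[apply] -[_ + _ _]; exact. Qed.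

Lemma pvm_idem S f : measurable S -> ell2 f -> E S (E S f) = E S f.
Proof. by case: hE => + _ _ _ => /[apply] -[_ _ + _]; exact. Qed.

Lemma pvm_adj S f g : measurable S -> ell2 f -> ell2 g ->
  rdot (E S f) g = rdot f (E S g).
Proof.
by case: hE => + _ _ _ => /[apply] -[_ _ _ h] lf lg; rewrite /rdot h.
Qed.

Lemma pvm0 f : ell2 f -> E set0 f = (fun=> 0).
Proof. by case: hE => _ + _ _ => /[apply] -[]. Qed.

Lemma pvmT f : ell2 f -> E setT f = f.
Proof. by case: hE => _ + _ _ => /[apply] -[]. Qed.

Lemma pvmI S B f : measurable S -> measurable B -> ell2 f ->
  E (S `&` B) f = E S (E B f).
Proof. by case: hE => _ _ h _; exact: h. Qed.

Lemma pvmD S f g : measurable S -> ell2 f -> ell2 g ->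
  E S (fun n => f n + g n) = (fun n => E S f n + E S g n).
Proof.
move=> mS lf lg; have := pvm_lin 1 mS lf lg.
under eq_fun do rewrite mul1r; move=> ->.
by under eq_fun do rewrite mul1r.
Qed.

Lemma pvm_cst0 S : measurable S -> E S (fun=> 0) = (fun=> 0).
Proof.
move=> mS; have := pvm_lin (-1) mS (ell20 R) (ell20 R).
under eq_fun do rewrite mulr0 addr0.
by move=> ->; apply/funext => n; rewrite mulN1r addNr.
Qed.

Lemma pvmZ S (c : C) f : measurable S -> ell2 f ->
  E S (fun n => c * f n) = (fun n => c * E S f n).
Proof.
move=> mS lf; have := pvm_lin c mS lf (ell20 R).
under eq_fun do rewrite addr0; move=> ->; rewrite pvm_cst0//.
by under eq_fun do rewrite addr0.
Qed.

Lemma pvmB S f g : measurable S -> ell2 f -> ell2 g ->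
  E S (fun n => f n - g n) = (fun n => E S f n - E S g n).
Proof.
move=> mS lf lg; have := pvm_lin (-1) mS lg lf.
under eq_fun do rewrite mulN1r addrC; move=> ->.
by apply/funext => n; rewrite mulN1r addrC.
Qed.

Lemma pvm_rdot S f : measurable S -> ell2 f -> rdot (E S f) f = nrm (E S f) ^+ 2.
Proof.
move=> mS lf; have lE := ell2_pvm mS lf.
by rewrite -(rdotff lE) -[in RHS]pvm_adj// pvm_idem.
Qed.

Lemma pvm_le S f : measurable S -> ell2 f -> nrm (E S f) <= nrm f.
Proof.
move=> mS lf; have lE := ell2_pvm mS lf.
have := rdot_le lE lf; rewrite pvm_rdot// expr2.
have [->|n0] := eqVneq (nrm (E S f)) 0; first by rewrite nrm_ge0.
by rewrite ler_pM2l// lt_def n0 nrm_ge0.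
Qed.

Lemma pvm_subset S B f : measurable S -> measurable B -> ell2 f ->
  S `<=` B -> E S f = E S (E B f).
Proof. by move=> mS mB lf /setIidPl SB; rewrite -pvmI// SB. Qed.

Lemma pvm_le_subset S B f : measurable S -> measurable B -> ell2 f ->
  S `<=` B -> nrm (E S f) <= nrm (E B f).
Proof.
move=> mS mB lf SB; rewrite (pvm_subset mS mB lf SB) pvm_le//.
exact: ell2_pvm.
Qed.

(** Countable additivity applied to [S], [B], [set0], [set0], ...: the partial sums are constant
    from the second on, so the norm of the difference is constant and equals its limit 0. *)
Lemma pvmU S B f : measurable S -> measurable B -> S `&` B = set0 -> ell2 f ->
  E (S `|` B) f = (fun n => E S f n + E B f n).
Proof.
move=> mS mB SB lf; have lS := ell2_pvm mS lf; have lB := ell2_pvm mB lf.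
have mU : measurable (S `|` B) by exact: measurableU.
have lU := ell2_pvm mU lf.
case: hE => _ _ _ /(_ (bigcup2 S B) f) h.
have {}h := h _ _ lf.
have : nrm (fun n => E (S `|` B) f n - (E S f n + E B f n))
    @[N --> \oo] --> (0 : R).
  apply: cvg_trans (h _ _); last 2 first.
  - case=> [|[|k]] //=; rewrite /bigcup2 /=; exact: measurable0.
  - by rewrite -trivIset_bigcup2.
  apply: near_eq_cvg; near=> N.
  have N2 : (2 <= N)%N by near: N; exact: nbhs_infty_ge.
  rewrite bigcup2E; congr ell2_norm; apply/funext => n; congr (_ - _).
  rewrite -(subnKC N2) big_split_ord /= 2!big_ord_recl big_ord0 /= addr0.
  by rewrite big1 ?addr0// => k _; rewrite /bigcup2 /= pvm0.
move=> /(cvg_unique (@norm_hausdorff _ _) (cvg_cst _)) nrm0E.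
have l12 := ell2D lS lB.
have h0 := nrm_eq0 (ell2B lU l12) nrm0E; apply/funext => n.
by apply/eqP; rewrite -subr_eq0; apply/eqP; have := congr1 (@^~ n) h0.
Unshelve. all: by end_near. Qed.

Lemma pvmC S f : measurable S -> ell2 f -> E (~` S) f = (fun n => f n - E S f n).
Proof.
move=> mS lf; have := pvmU mS (measurableC mS) (setICr S) lf.
rewrite setUv pvmT// => {2}->.
by apply/funext => n; rewrite addrC addKr.
Qed.

Lemma pvm_pythagoras S f : measurable S -> ell2 f ->
  nrm f ^+ 2 = nrm (E S f) ^+ 2 + nrm (E (~` S) f) ^+ 2.
Proof.
move=> mS lf; rewrite -(pvm_rdot mS lf) -(pvm_rdot (measurableC mS) lf).
have lS := ell2_pvm mS lf; rewrite pvmC// rdotBl// (rdotff lf); ring.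
Qed.

(** * The spectral measure of a single vector *)

Section SpectralMeasure.
Variables (f : int -> C) (lf : ell2 f).

Lemma spectral_measureE S : measurable S ->
  spectral_measure E f S = (nrm (E S f) ^+ 2)%:E.
Proof. by move=> mS; rewrite /spectral_measure -/(rdot _ _) pvm_rdot. Qed.

(* Unlike [spectral_measure], nonnegative on non-measurable sets too. *)
Definition energy of is_pvm E & ell2 f := fun S => (nrm (E S f) ^+ 2)%:E.

Local Notation mu := (energy hE lf).

Let energy0 : mu set0 = 0%E.
Proof. by rewrite /energy pvm0// nrm0 expr0n. Qed.

Let energy_ge0 S : (0 <= mu S)%E.
Proof. by rewrite lee_fin sqr_ge0. Qed.

(** Partial sums of the measure are inner products of [f] with partial sums of the vectors E (F k)
    f. These vectors converge in norm, and Cauchy-Schwarz transfers the convergence. *)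
Let energy_semi_sigma_additive : semi_sigma_additive mu.
Proof.
move=> F mF tF mUF; have lU := ell2_pvm mUF lf.
have lF N : ell2 (fun n => \sum_(k < N) E (F k) f n).
  elim: N => [|N IH]; first by under eq_fun do rewrite big_ord0; exact: ell20.
  under eq_fun do rewrite big_ord_recr /=.
  by apply: ell2D => //; exact: ell2_pvm.
have sumE N : \sum_(0 <= k < N) mu (F k) =
    (rdot (fun n => \sum_(k < N) E (F k) f n) f)%:E.
  elim: N => [|N IH].
    rewrite big_geq//; under eq_fun do rewrite big_ord0.
    by rewrite (_ : rdot _ _ = 0)// -(pvm0 lf) pvm_rdot// pvm0// nrm0 expr0n.
  rewrite big_nat_recr//= IH; under [in RHS]eq_fun do rewrite big_ord_recr /=.
  rewrite (rdotDl (lF N) (ell2_pvm (mF N) lf) lf).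
  by rewrite EFinD pvm_rdot.
under eq_fun do rewrite sumE.
apply: cvg_EFin; first by apply: nearW.
rewrite /= -(pvm_rdot mUF lf).
have [_ _ _ /(_ F f mF tF lf) h] := hE.
(* The summand 1 keeps the divisor positive when [f] has norm zero. *)
apply/cvgrPdist_le => e e0; have nf0 : 0 < nrm f + 1 by rewrite ltr_wpDl ?nrm_ge0.
have /cvgrPdist_le /(_ (e / (nrm f + 1))) := h; rewrite divr_gt0// => /(_ isT).
apply: filterS => N; rewrite sub0r normrN ger0_norm ?nrm_ge0// => hN.
rewrite -(rdotBl lU (lF N) lf); have lB := ell2B lU (lF N).
have nle : nrm (fun n => E (\bigcup_k F k) f n - \sum_(k < N) E (F k) f n) * nrm f <= e.
  apply: (@le_trans _ _ (e / (nrm f + 1) * (nrm f + 1))).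
    by rewrite ler_pM ?nrm_ge0// lerDl.
  by rewrite divfK// gt_eqF.
rewrite ler_norml; apply/andP; split; last exact: le_trans (rdot_le _ _) nle.
rewrite lerNl -rdotNl//; apply: le_trans (rdot_le (ell2N lB) lf) _.
by rewrite nrmN.
Qed.

HB.instance Definition _ := isMeasure.Build _ _ _ mu
  energy0 energy_ge0 energy_semi_sigma_additive.


Lemma energyE S : measurable S -> mu S = spectral_measure E f S.
Proof. by move=> mS; rewrite spectral_measureE. Qed.

Lemma energyT : mu setT = (nrm f ^+ 2)%:E.
Proof. by rewrite /energy pvmT. Qed.

Lemma energy_fin : (mu setT < +oo)%E.
Proof. by rewrite energyT ltry. Qed.

End SpectralMeasure.

Lemma energy_cap f (lf : ell2 f) S (mS : measurable S) B : measurable B ->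
  energy hE (ell2_pvm mS lf) B = energy hE lf (B `&` S).
Proof. by move=> mB; rewrite /energy pvmI. Qed.

(** Continuity from above of the finite measure [energy], read as strong convergence of the
    projections to 0. *)
Lemma pvm_cap_cvg f (F : (set T)^nat) : ell2 f -> (forall k, measurable (F k)) ->
  {homo F : n m / (n <= m)%N >-> m `<=` n} -> \bigcap_k F k = set0 ->
  nrm (E (F k) f) @[k --> \oo] --> (0 : R).
Proof.
move=> lf mF dF F0.
have h : (energy hE lf \o F) k @[k --> \oo] --> 0%:E.
  have <- : energy hE lf (\bigcap_k F k) = 0%:E by rewrite F0 measure0.
  apply: nonincreasing_cvg_mu => //.
  - by rewrite /= /energy ltry.
  - by rewrite F0; exact: measurable0.
  - by move=> n m nm; rewrite subsetEset; exact: dF.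
move/fine_cvgP: h => [_ /cvgrPdist_lt h].
apply/cvgrPdist_lt => e e0; have := h (e ^+ 2); rewrite exprn_gt0// => /(_ isT).
apply: filterS => k /=; rewrite !sub0r !normrN !ger0_norm ?nrm_ge0 ?sqr_ge0//.
by rewrite ltr_pXn2r// nnegrE ?nrm_ge0 ?ltW.
Qed.

End Pvm.

(** * Operators with a spectral resolution: form bounds and invariance of spectral subspaces *)

Section Resolution.
Variable R : realType.
Local Notation C := R[i].
Local Notation T := (measurableTypeR R).
Local Notation nrm := (@ell2_norm R).
Variable E : set T -> (int -> C) -> (int -> C).
Variable G : op_graph R.
Hypothesis hG : is_spectral_resolution G E.
Hypothesis Gell2 : forall f g, G (f, g) -> ell2 f /\ ell2 g.
Hypothesis Glin : forall (c : C) f1 g1 f2 g2, G (f1, g1) -> G (f2, g2) ->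
  G ((fun n => c * f1 n + f2 n), (fun n => c * g1 n + g2 n)).
Implicit Types (f g a b u w : int -> C) (S B : set T).

Let hE : is_pvm E. Proof. by case: hG. Qed.

Lemma dom_second_moment f (lf : ell2 f) :
  (exists g, G (f, g)) <-> (second_moment (energy hE lf) < +oo)%E.
Proof.
case: hG => _ /(_ f lf) -> _; rewrite /second_moment.
by rewrite (eq_integral_set_fun _ _ (energyE hE lf)).
Qed.

Lemma graph_form f g (lf : ell2 f) : G (f, g) ->
  dot g f = (fine (first_moment (energy hE lf)))%:C.
Proof.
case: hG => _ _ h /h ->; rewrite /first_moment.
by rewrite (eq_integral_set_fun _ _ (energyE hE lf)).
Qed.

Lemma graph_rdot f g (lf : ell2 f) : G (f, g) ->
  rdot g f = fine (first_moment (energy hE lf)).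
Proof. by move=> /graph_form h; rewrite /rdot h. Qed.

Lemma graph_add f1 g1 f2 g2 : G (f1, g1) -> G (f2, g2) ->
  G ((fun n => f1 n + f2 n), (fun n => g1 n + g2 n)).
Proof.
move=> G1 G2; have := Glin 1 G1 G2.
by under eq_fun do rewrite mul1r; under [X in (_, X)]eq_fun do rewrite mul1r.
Qed.

Lemma graph_sub f1 g1 f2 g2 : G (f1, g1) -> G (f2, g2) ->
  G ((fun n => f1 n - f2 n), (fun n => g1 n - g2 n)).
Proof.
move=> G1 G2; have := Glin (-1) G2 G1.
by under eq_fun do rewrite mulN1r addrC;
  under [X in (_, X)]eq_fun do rewrite mulN1r addrC.
Qed.

(** The spectral measure of E S f is that of [f] restricted to [S], so its second moment can only
    decrease. *)
Lemma graph_pvm S f g : measurable S -> G (f, g) -> exists g', G (E S f, g').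
Proof.
move=> mS Gf; have [lf _] := Gell2 Gf.
have /(dom_second_moment lf) fin : exists g, G (f, g) by exists g.
apply/(dom_second_moment (ell2_pvm hE mS lf)); apply: le_lt_trans fin.
apply: le_second_moment => B mB; have mBS := measurableI _ _ mB mS.
rewrite [leLHS](energy_cap hE lf mS mB).
by rewrite le_measure// ?inE.
Qed.

Lemma energy_setC S a (la : ell2 a) : measurable S -> E S a = a ->
  energy hE la (~` S) = 0%E.
Proof.
move=> mS Ea; rewrite /energy (pvmC hE mS la) Ea.
by under eq_fun do rewrite subrr; rewrite nrm0 expr0n.
Qed.

Lemma graph_bounded S a (M : R) : measurable S -> ell2 a -> E S a = a ->
  (forall x, S x -> x ^+ 2 <= M) -> exists g, G (a, g).
Proof.
move=> mS la Ea SM; apply/(dom_second_moment la).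
apply: (second_moment_bounded mS _ (energy_setC la mS Ea) SM).
exact: energy_fin.
Qed.

Lemma graph_le S a g (d : R) : measurable S -> E S a = a -> G (a, g) ->
  (forall x, S x -> x <= d) -> rdot g a <= d * nrm a ^+ 2.
Proof.
move=> mS Ea Ga Sd; have [la _] := Gell2 Ga.
rewrite (graph_rdot la Ga).
have -> : nrm a ^+ 2 = fine (energy hE la setT) by rewrite energyT.
apply: (first_moment_le mS _ _ (energy_setC la mS Ea) Sd).
- exact: energy_fin.
- by apply/(dom_second_moment la); exists g.
Qed.

Lemma graph_ge S a g (c : R) : measurable S -> E S a = a -> G (a, g) ->
  (forall x, S x -> c <= x) -> c * nrm a ^+ 2 <= rdot g a.
Proof.
move=> mS Ea Ga Sd; have [la _] := Gell2 Ga.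
rewrite (graph_rdot la Ga).
have -> : nrm a ^+ 2 = fine (energy hE la setT) by rewrite energyT.
apply: (first_moment_ge mS _ _ (energy_setC la mS Ea) Sd).
- exact: energy_fin.
- by apply/(dom_second_moment la); exists g.
Qed.

(* The form [dot g f] is real on the graph; apply this to [f = 'i a + b]. *)
Lemma graph_sym a ga b gb : G (a, ga) -> G (b, gb) -> rdot ga b = rdot a gb.
Proof.
move=> Ga Gb; have [la lga] := Gell2 Ga; have [lb lgb] := Gell2 Gb.
have real f g : G (f, g) -> rdot (fun n => 'i * g n) f = 0.
  move=> Gf; have [lf _] := Gell2 Gf.
  by rewrite rdot_iC (graph_form lf Gf) /= oppr0.
have := real _ _ (Glin 'i Ga Gb).
have -> : (fun n => 'i * ('i * ga n + gb n)) = (fun n => 'i * gb n - ga n).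
  by apply/funext => n; rewrite mulrDr mulrA -expr2 sqrCi mulN1r addrC.
have l1 := ell2Z 'i la; have l2 := ell2Z 'i lgb.
rewrite (rdotDr l1 lb (ell2B l2 lga)) !(rdotBl l2 lga)//.
rewrite rdot_ii (real _ _ Gb) (rdotC ga (fun n => 'i * a n)).
rewrite (_ : rdot (fun n => 'i * a n) ga = 0) ?(rdotC a gb); first lra.
by rewrite rdotC rdot_i (graph_form la Ga).
Qed.

(** The spectral measure of a + b is that of a on [S] and that of b off [S], so the quadratic form
    is additive on the pair. Expanding the form at a + b leaves the two cross terms, which are equal
    by [graph_sym]; hence each vanishes. *)
Lemma graph_cross S a ga b gb : measurable S -> E S a = a -> E (~` S) b = b ->
  G (a, ga) -> G (b, gb) -> rdot gb a = 0.
Proof.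
move=> mS Ea Eb Ga Gb; have mS' := measurableC mS.
have [la lga] := Gell2 Ga; have [lb lgb] := Gell2 Gb.
have Gab := graph_add Ga Gb; have [lab _] := Gell2 Gab.
have zb : energy hE lb S = 0%E.
  by have := energy_setC lb mS' Eb; rewrite setCK.
have za := energy_setC la mS Ea.
have sub0 f (lf : ell2 f) S' B : measurable S' -> measurable B -> B `<=` S' ->
    energy hE lf S' = 0%E -> E B f = (fun=> 0).
  move=> mS1 mB BS [] /eqP; rewrite sqrf_eq0 => /eqP z.
  apply: nrm_eq0; first exact: ell2_pvm.
  by apply/eqP; rewrite eq_le nrm_ge0 andbT -z pvm_le_subset.
have agreeS B : measurable B -> B `<=` S -> energy hE lab B = energy hE la B.
  move=> mB BS; rewrite /energy (pvmD hE)// (sub0 _ lb S)//.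
  by under eq_fun do rewrite addr0.
have agreeC B : measurable B -> B `<=` ~` S -> energy hE lab B = energy hE lb B.
  move=> mB BS; rewrite /energy (pvmD hE)// (sub0 _ la (~` S))//.
  by under eq_fun do rewrite add0r.
have split : first_moment (energy hE lab) =
    (first_moment (energy hE la) + first_moment (energy hE lb))%E.
  exact: (first_moment_additive mS agreeS agreeC za zb).
have fin f (lf : ell2 f) g : G (f, g) -> first_moment (energy hE lf) \is a fin_num.
  move=> Gf; apply: integrable_fin_num => //; apply: integrable_first_moment.
    exact: energy_fin.
  by apply/(dom_second_moment lf); exists g.
have := graph_rdot lab Gab; rewrite split fineD; [|exact: fin Ga|exact: fin Gb].
rewrite -(graph_rdot la Ga) -(graph_rdot lb Gb).
rewrite (rdotDl lga lgb lab) !rdotDr// (graph_sym Ga Gb) (rdotC a gb); lra.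
Qed.

(** Split [w] into E S w and the remainder. The cross term vanishes by [graph_cross], and what is
    left is the form on the range of E S, whose sign is that of x on [S]. *)
Lemma graph_sign S w g (s : R) : measurable S -> (forall x, S x -> s * x <= 0) ->
  G (w, g) -> s * rdot g (E S w) <= 0.
Proof.
move=> mS Ss Gw; have [lw lg] := Gell2 Gw; have lE := ell2_pvm hE mS lw.
have [ga Ga] := graph_pvm mS Gw; have [_ lga] := Gell2 Ga.
have Gb := graph_sub Gw Ga; have [lb lgb] := Gell2 Gb.
have Ea : E S (E S w) = E S w by rewrite (pvm_idem hE).
have Eb : E (~` S) (fun n => w n - E S w n) = (fun n => w n - E S w n).
  by rewrite -(pvmC hE)// (pvm_idem hE)//; exact: measurableC.
have := graph_cross mS Ea Eb Ga Gb; rewrite rdotBl// => /eqP.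
rewrite subr_eq0 => /eqP ->.
have [s0|s0|s0] := ltgtP s 0; last by rewrite s0 mul0r.
- have := @graph_ge S _ _ 0 mS Ea Ga; rewrite mul0r nmulr_rle0//; apply.
  by move=> x /Ss; rewrite nmulr_rle0.
- have := @graph_le S _ _ 0 mS Ea Ga; rewrite mul0r pmulr_rle0//; apply.
  by move=> x /Ss; rewrite pmulr_rle0.
Qed.

(** The resolution prescribes only the domain and the quadratic form, so invariance has to be
    derived. Put b = E (I m [&] ~[S) g, which lies in the domain because its spectral support is
    bounded. Writing A for the operator, |b|^2 = <b, g> = <A b, a> = 0 by symmetry
    and]graph_cross[. Letting m grow gives E (~] S) g = 0. *)
Lemma graph_inv S a g : measurable S -> E S a = a -> G (a, g) -> E S g = g.
Proof.
move=> mS Ea Ga; have [la lg] := Gell2 Ga; have mS' := measurableC mS.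
pose I (m : nat) : set T := [set x : R | x ^+ 2 <= m%:R].
have mI m : measurable (I m).
  rewrite (_ : I m = setT `&` (fun x : R => x ^+ 2) @^-1` `]-oo, m%:R]).
    apply: (measurable_funX 2 (@measurable_id _ _ setT)) => //.
  by rewrite setTI; apply/seteqP; split => x; rewrite /I /= in_itv.
have z m : E (~` S) (E (I m) g) = (fun=> 0).
  have lI := ell2_pvm hE (mI m) lg; have lSI := ell2_pvm hE mS' lI.
  apply: nrm_eq0 => //; apply/eqP; rewrite -sqrf_eq0.
  have mIS := measurableI _ _ (mI m) mS'.
  have e1 : E (I m `&` ~` S) g = E (~` S) (E (I m) g) by rewrite setIC (pvmI hE).
  have e2 : E (I m `&` ~` S) (E (I m `&` ~` S) g) = E (I m `&` ~` S) g.
    by rewrite (pvm_idem hE).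
  have [gb Gb] : exists gb, G (E (I m `&` ~` S) g, gb).
    apply: (graph_bounded mIS _ e2 (M := m%:R)); first exact: ell2_pvm.
    by move=> x [].
  have e3 : E (~` S) (E (I m `&` ~` S) g) = E (I m `&` ~` S) g.
    by rewrite e1 (pvm_idem hE).
  have := graph_cross mS Ea e3 Ga Gb; rewrite (graph_sym Gb Ga) => h.
  by rewrite -e1 -(pvm_rdot hE mIS lg) h.
have h : nrm (E (~` I k) (E (~` S) g)) @[k --> \oo] --> (0 : R).
  apply: (pvm_cap_cvg hE) => //.
  - exact: ell2_pvm.
  - by move=> k; exact: measurableC.
  - move=> n m nm x; rewrite /I /= => h1 h2; apply: h1; apply: le_trans h2 _.
    by rewrite ler_nat.
  - apply/seteqP; split => // x h; have := h (Num.truncn (x ^+ 2)).+1 Logic.I.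
    by rewrite /I /=; apply; rewrite ltW// truncnS_gt.
have z2 m : E (~` I m) (E (~` S) g) = E (~` S) g.
  have lS := ell2_pvm hE mS' lg.
  rewrite (pvmC hE)// -(pvmI hE)// setIC pvmI// z.
  by under eq_fun do rewrite subr0.
have h2 : nrm (E (~` S) g) = 0.
  move: h; under eq_fun do rewrite z2.
  by move/(cvg_unique (@norm_hausdorff _ _) (cvg_cst _)).
have := nrm_eq0 (ell2_pvm hE mS' lg) h2; rewrite (pvmC hE)// => h3.
by apply/funext => n; apply/esym/eqP; rewrite -subr_eq0; apply/eqP/(congr1 (@^~ n) h3).
Qed.

(** With T = A - c, where A is the operator, and b = T u, expand 0 <= <T v, v> at v = u - t b and
    bound <T b, b> by (d - c) |b|^2. The choice t = 1 / (d - c) gives |b|^2 <= (d - c) <b, u>, and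
    <b, u> <= (d - c) |u|^2. *)
Lemma approx_eigenvector S u (c d : R) : measurable S -> c <= d ->
  (forall x, S x -> c <= x <= d) -> ell2 u -> E S u = u ->
  exists2 g, G (u, g) & nrm (fun n => g n - c%:C * u n) <= (d - c) * nrm u.
Proof.
move=> mS cd Scd lu Eu.
have dom a : ell2 a -> E S a = a -> exists g, G (a, g).
  move=> la Ea; apply: (graph_bounded mS la Ea (M := c ^+ 2 + d ^+ 2)).
  move=> x /Scd /andP[cx xd].
  have c2 := sqr_ge0 c; have d2 := sqr_ge0 d.
  have [x0|x0] := leP 0 x.
    have : 0 <= (d - x) * (d + x) by apply: mulr_ge0; lra.
    lra.
  have : 0 <= (x - c) * (- x - c) by apply: mulr_ge0; lra.
  lra.
have [g Gu] := dom _ lu Eu; exists g => //; have [_ lg] := Gell2 Gu.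
pose b n := g n - c%:C * u n.
have lcu := ell2Z c%:C lu; have lb : ell2 b by exact: ell2B.
have Eb : E S b = b by rewrite /b (pvmB hE)// (pvmZ hE)// Eu (graph_inv mS Eu Gu).
have [h Gb] := dom _ lb Eb; have [_ lh] := Gell2 Gb.
(* [A - c] is between [0] and [d - c] on the range of [E S]. *)
rewrite -/b; set N := nrm b.
have N2 : N ^+ 2 = rdot g b - c * rdot u b.
  by rewrite -(rdotff lb) {1}/b rdotBl// rdotZl.
have up : rdot h b <= d * N ^+ 2 by apply: (graph_le mS Eb Gb) => x /Scd /andP[].
have upu : rdot g u <= d * nrm u ^+ 2 by apply: (graph_le mS Eu Gu) => x /Scd /andP[].
have sym := graph_sym Gu Gb.
have pos (t : R) : 0 <= (rdot g u - c * nrm u ^+ 2) - 2 * t * N ^+ 2 +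
    t ^+ 2 * ((d - c) * N ^+ 2).
  have Gv := Glin (- t)%:C Gb Gu.
  have Ev : E S (fun n => (- t)%:C * b n + u n) = (fun n => (- t)%:C * b n + u n).
    by rewrite (pvm_lin hE)// Eb Eu.
  have := @graph_ge S _ _ c mS Ev Gv; have [lv lgv] := Gell2 Gv.
  have ltb := ell2Z (- t)%:C lb; have lth := ell2Z (- t)%:C lh.
  rewrite -(rdotff lv) (rdotDl lth lg lv) (rdotDl ltb lu lv).
  rewrite !(rdotDr ltb lu)// !rdotZl// !rdotZr// (rdotff lb) (rdotff lu) (rdotC b u).
  rewrite (rdotC h u) -sym => /(_ (fun x Sx => proj1 (andP (Scd x Sx)))).
  have t2 := sqr_ge0 t; have := ler_wpM2l t2 up; rewrite -/N.
  have tN : t * N ^+ 2 = t * (rdot g b - c * rdot u b) by rewrite N2.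
  lra.
have N0 : 0 <= N by exact: nrm_ge0.
have dc0 : 0 <= d - c by rewrite subr_ge0.
rewrite -(@ler_pXn2r _ 2)// ?nnegrE ?mulr_ge0 ?nrm_ge0// exprMn.
(* In the degenerate case the term in t^2 vanishes and <b, u> <= 0, so t = 1 already forces b = 0.
   This case is what turns a point of the spectrum into an exact eigenvector. *)
have [dc|dc] := eqVneq (d - c) 0.
  have e : d = c by lra.
  by rewrite dc expr0n mul0r; have := pos 1; move: upu; rewrite dc e; lra.
have dcp : 0 < d - c by rewrite lt_def dc.
have := pos (d - c)^-1; rewrite -(pmulr_rge0 _ dcp) => h1.
have e1 : (d - c) * (d - c)^-1 = 1 by rewrite divff.
suff : (d - c) * (rdot g u - c * nrm u ^+ 2) <= (d - c) * ((d - c) * nrm u ^+ 2).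
  have e2 : (d - c) * ((rdot g u - c * nrm u ^+ 2) - 2 * (d - c)^-1 * N ^+ 2 +
    (d - c)^-1 ^+ 2 * ((d - c) * N ^+ 2)) =
    (d - c) * (rdot g u - c * nrm u ^+ 2) - 2 * ((d - c) * (d - c)^-1) * N ^+ 2 +
     ((d - c) * (d - c)^-1) ^+ 2 * N ^+ 2 by ring.
  by move: h1; rewrite e2 e1; lra.
by rewrite ler_pM2l//; lra.
Qed.

End Resolution.

(** * Tridiagonal operators *)

Section Tridiagonal.
Variable R : realType.
Local Notation C := R[i].
Local Notation nrm := (@ell2_norm R).
Local Notation normc := ComplexField.Normc.normc.
Implicit Types (f g h : int -> C).

Lemma normc_ge0 (c : C) : 0 <= normc c.
Proof. by case: c => a b; exact: sqrtr_ge0. Qed.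

Lemma normcD (c d : C) : normc (c + d) <= normc c + normc d.
Proof. exact: le_normcD. Qed.

Lemma normcN (c : C) : normc (- c) = normc c.
Proof. exact: complex.normcN. Qed.

Lemma nrmZC (c : C) f : ell2 f -> nrm (fun n => c * f n) = normc c * nrm f.
Proof.
move=> lf; have lcf := ell2Z c lf.
apply/eqP; rewrite -(@eqrXn2 _ 2)// ?mulr_ge0 ?nrm_ge0 ?normc_ge0//.
have s0 (g : int -> C) n : 0 <= sqn (g n) by exact: sqn_ge0.
rewrite exprMn !sqr_sqrtr ?fine_ge0// ?psum_ge0//; try by move=> n; exact: sqr_ge0.
rewrite (_ : (\esum_(n in [set: int]) (normc (c * f n) ^+ 2)%:E)%E =
   ((sqn c)%:E * psum (fun n => sqn (f n)))%E).
  by rewrite fineM//; apply: fin_psum.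
rewrite -psumZ ?sqn_ge0//.
apply: eq_esum => n _.
by congr (_%:E); exact: sqnM.
Qed.

Variables p q r : int -> C.

Definition tridiag f n := p n * f (n + 1) + q n * f n + r n * f (n - 1).

Lemma tridiag_lin (c : C) f g :
  tridiag (fun n => c * f n + g n) = (fun n => c * tridiag f n + tridiag g n).
Proof. by apply/funext => n; rewrite /tridiag; ring. Qed.

Lemma finsupp_subset (X : set int) f : finite_set X ->
  (forall n, f n != 0 -> X n) -> finsupp f.
Proof. by move=> fX sub; apply: sub_finite_set fX. Qed.

Lemma finsupp_lin (c : C) f g : finsupp f -> finsupp g ->
  finsupp (fun n => c * f n + g n).
Proof.
move=> ff fg; apply: (@finsupp_subset ([set n | f n != 0] `|` [set n | g n != 0])).
  by rewrite finite_setU.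
move=> n /=; apply: contraPP => /not_orP[/negP + /negP].
rewrite !negbK => /eqP -> /eqP ->; rewrite mulr0 addr0 eqxx; exact.
Qed.

Lemma finsupp_tridiag f : finsupp f -> finsupp (tridiag f).
Proof.
move=> ff; pose X := [set n | f n != 0].
apply: (@finsupp_subset ((fun n => n - 1) @` X `|` X `|` (fun n => n + 1) @` X)).
  by rewrite !finite_setU; split; [split|] => //; exact: finite_image.
move=> n; apply: contraPP => /not_orP[/not_orP[h1 h2] h3].
have f1 : f (n + 1) = 0.
  by apply: contra_notP h1 => /eqP h; exists (n + 1) => //; rewrite addrK.
have f2 : f n = 0 by apply: contra_notP h2 => /eqP h.
have f3 : f (n - 1) = 0.
  by apply: contra_notP h3 => /eqP h; exists (n - 1) => //; rewrite subrK.
by rewrite /tridiag f1 f2 f3 !mulr0 !addr0 eqxx.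
Qed.

Lemma closure_core h : finsupp h -> op_closure tridiag (h, tridiag h).
Proof.
move=> fh; have fD := finsupp_tridiag fh.
split; first exact: ell2_finsupp.
split; first exact: ell2_finsupp.
have z (u : int -> C) : nrm (fun n => u n - u n) = 0.
  by under eq_fun do rewrite subrr; rewrite nrm0.
by move=> e e0; exists h; split => //=; rewrite !z.
Qed.

Lemma closure_lin (c : C) f1 g1 f2 g2 :
  op_closure tridiag (f1, g1) -> op_closure tridiag (f2, g2) ->
  op_closure tridiag ((fun n => c * f1 n + f2 n), (fun n => c * g1 n + g2 n)).
Proof.
move=> [/= lf1 [lg1 h1]] [/= lf2 [lg2 h2]].
split => /=; first by apply: ell2D => //; exact: ell2Z.
split; first by apply: ell2D => //; exact: ell2Z.
move=> e e0; have c0 := normc_ge0 c.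
pose d := e / (normc c + 1) / 2.
have d0 : 0 < d by rewrite /d !divr_gt0//; lra.
have de : normc c * d + d = e / 2.
  by rewrite -{2}[d]mul1r -mulrDl /d mulrA [_ * (e / _)]mulrC divfK//; lra.
have [k1 [fk1 [a1 b1]]] := h1 d d0; have [k2 [fk2 [a2 b2]]] := h2 d d0.
exists (fun n => c * k1 n + k2 n); split; first exact: finsupp_lin.
have est (u1 u2 v1 v2 : int -> C) : ell2 u1 -> ell2 u2 -> ell2 v1 -> ell2 v2 ->
    nrm (fun n => u1 n - v1 n) < d -> nrm (fun n => u2 n - v2 n) < d ->
    nrm (fun n => c * u1 n + u2 n - (c * v1 n + v2 n)) < e.
  move=> l1 l2 l3 l4 n1 n2.
  rewrite (_ : (fun n => _) = (fun n => c * (u1 n - v1 n) + (u2 n - v2 n))); last first.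
    by apply/funext => n; ring.
  have l13 := ell2B l1 l3; have l24 := ell2B l2 l4.
  apply: le_lt_trans (nrmD (ell2Z c l13) l24) _; rewrite (nrmZC c l13).
  have := ler_wpM2l c0 (ltW n1); lra.
have lk1 := ell2_finsupp fk1; have lk2 := ell2_finsupp fk2.
split; first exact: est.
rewrite tridiag_lin; apply: est => //; apply: ell2_finsupp; exact: finsupp_tridiag.
Qed.

(** Norm convergence implies pointwise convergence, and each value of [tridiag] involves three
    values only; hence the closure acts by the same difference formula. *)
Lemma closure_tridiag f g : op_closure tridiag (f, g) -> tridiag f = g.
Proof.
move=> [/= lf [lg h]]; apply/funext => n; apply/eqP; rewrite -subr_eq0; apply/eqP.
apply: ComplexField.Normc.eq0_normc; apply/eqP; rewrite eq_le normc_ge0 andbT.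
apply/ler_addgt0Pr => e e0; rewrite add0r.
(* The three coefficients weigh the errors in [f]; the last summand 1 accounts for the error in
   [g]. *)
pose M := normc (p n) + normc (q n) + normc (r n) + 1.
have M0 : 0 < M by rewrite ltr_wpDl// !addr_ge0// normc_ge0.
have [k [fk [a b]]] := h (e / M) (divr_gt0 e0 M0).
have lk := ell2_finsupp fk; have lDk := ell2_finsupp (finsupp_tridiag fk).
have am m : normc (f m - k m) <= e / M.
  exact: le_trans (normc_le_nrm m (ell2B lf lk)) (ltW a).
have bn := le_trans (normc_le_nrm n (ell2B lg lDk)) (ltW b).
have -> : tridiag f n - g n = p n * (f (n + 1) - k (n + 1)) + q n * (f n - k n)
    + r n * (f (n - 1) - k (n - 1)) - (g n - tridiag k n).
  by rewrite /tridiag; ring.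
apply: le_trans (normcD _ _) _; rewrite normcN.
apply: le_trans (lerD (le_trans (normcD _ _) (lerD (normcD _ _) (lexx _))) (lexx _)) _.
rewrite !ComplexField.Normc.normcM.
have -> : e = normc (p n) * (e / M) + normc (q n) * (e / M) + normc (r n) * (e / M) + e / M.
  rewrite -!mulrDl -[X in _ + X]mul1r -mulrDl -/M mulrC divfK//; lra.
by rewrite !lerD// ler_wpM2l ?normc_ge0.
Qed.

End Tridiagonal.

(** * The kernel of the gamma operator *)

Section HalfLineRecurrence.
Variable R : realType.
Local Notation C := R[i].
Local Notation normc := ComplexField.Normc.normc.

Lemma sum_le_psum (a : int -> R) (m : int) N : (forall n, 0 <= a n) ->
  ((\sum_(0 <= k < N) a (m + k%:Z))%:E <= psum a)%E.
Proof.
move=> a0; pose s := [seq m + k%:Z | k <- index_iota 0 N].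
have us : uniq s by rewrite map_inj_uniq ?iota_uniq// => x y /addrI [].
apply: esum_ge; exists [set` s]; first by split => //; exact: finite_seq.
by rewrite -fsbig_seq//= sumEFin big_map.
Qed.

Lemma normc_eq0 (c : C) : (normc c == 0) = (c == 0).
Proof.
apply/eqP/eqP => [/ComplexField.Normc.eq0_normc//|->].
exact: ComplexField.Normc.normc0.
Qed.

Lemma normc_nat n : normc (n%:R : C) = n%:R.
Proof.
rewrite (_ : n%:R = (n%:R : R)%:C); last by rewrite rmorph_nat.
by rewrite /= expr0n addr0 sqrtr_sqr ger0_norm.
Qed.

Lemma normcB (c d : C) : normc (c - d) <= normc c + normc d.
Proof. by rewrite (le_trans (normcD _ _))// normcN. Qed.

Variables (z z' : C) (alpha f : nat -> C).
Let u n := z + n.+1%:R.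
Let v n := z' + n.+1%:R.
Hypothesis alpha2 : forall n, alpha n ^+ 2 = u n * v n.
Hypothesis u0 : forall n, u n != 0.
Hypothesis v0 : forall n, v n != 0.
(** This bound keeps [psi] bounded by 1; the next one makes (n + 1) |f n|^2 nondecreasing once [f]
    satisfies a first-order recurrence. *)
Hypothesis vu : forall n, normc (v n) <= normc (u n).
Hypothesis uv : forall n, n.+1%:R * normc (u n) <= n.+2%:R * normc (v n).
Hypothesis rec : forall n,
  alpha n.+1 * f n.+2 - (u n.+1 + v n) * f n.+1 + alpha n * f n = 0.
Hypothesis bounded_sums :
  exists M, forall N, \sum_(0 <= k < N) sqn (f k) <= M.

Let alpha0 n : alpha n != 0.
Proof. by rewrite -sqrf_eq0 alpha2 mulf_neq0. Qed.

Let nalpha n : normc (alpha n) ^+ 2 = normc (u n) * normc (v n).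
Proof. by rewrite -ComplexField.Normc.normcM -alpha2 !expr2 ComplexField.Normc.normcM. Qed.

Let npos (c : C) : c != 0 -> 0 < normc c.
Proof. by move=> c0; rewrite lt_def normc_eq0 c0 normc_ge0. Qed.

Let f_cvg0 : (fun n => normc (f n)) @ \oo --> (0 : R).
Proof.
case: bounded_sums => M hM.
have cv : cvgn (series (fun n => sqn (f n))).
  apply: nondecreasing_is_cvgn.
    by apply: nondecreasing_series => n _ _; exact: sqn_ge0.
  by exists M => _ [N _ <-]; exact: hM.
have /cvgrPdist_lt h := cvg_series_cvg_0 cv.
apply/cvgrPdist_lt => e e0; have := h (e ^+ 2); rewrite exprn_gt0// => /(_ isT).
apply: filterS => k /=; rewrite !sub0r !normrN !ger0_norm ?normc_ge0 ?sqn_ge0//.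
by rewrite /sqn ltr_pXn2r// nnegrE ?normc_ge0 ?ltW.
Qed.

(* [1 / psi] is an exact solution of the recurrence. *)
Let psi := fix psi n : C := if n is m.+1 then psi m * (v m / alpha m) else 1.
Let g n := f n * psi n.

Let psiS n : psi n.+1 = psi n * (v n / alpha n). Proof. by []. Qed.

Let psi0 n : psi n != 0.
Proof.
elim: n => [|n IH]; first exact: oner_neq0.
by rewrite psiS mulf_neq0// mulf_neq0// invr_eq0.
Qed.

Let psi_le1 n : normc (psi n) <= 1.
Proof.
elim: n => [|n IH]; first by rewrite [psi 0](erefl : _ = 1) (normc_nat 1 : normc 1 = 1).
rewrite psiS.
rewrite ComplexField.Normc.normcM mulr_ile1 ?normc_ge0//.
rewrite ComplexField.Normc.normcM ComplexField.Normc.normcV.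
rewrite ler_pdivrMr ?npos// mul1r -(@ler_pXn2r _ 2)// ?nnegrE ?normc_ge0//.
by rewrite nalpha expr2 ler_pM2r ?npos.
Qed.

(** This is alpha n * (f n.+1 * psi n - f n * psi n.+1) written in terms of [g]. It is constant
    because [psi] itself solves the recurrence too, thanks to u n + v n.+1 = u n.+1 + v n. *)
Let wronskian n := u n * g n.+1 - v n * g n.

Let wronskian_cst n : wronskian n = wronskian 0.
Proof.
elim: n => // n <-; apply/eqP; rewrite -subr_eq0 /wronskian.
have e1 : alpha n * f n * psi n.+1 = v n * g n.
  rewrite /g psiS; field; exact: alpha0.
have e2 : alpha n.+1 * f n.+2 * psi n.+1 = u n.+1 * g n.+2.
  rewrite /g (psiS n.+1).
  transitivity (alpha n.+1 ^+ 2 * f n.+2 * psi n.+1 / alpha n.+1).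
    by field; exact: alpha0.
  rewrite alpha2; ring.
have := congr1 (fun x => x * psi n.+1) (rec n).
rewrite mul0r mulrDl mulrBl e1 e2 -[in X in _ - X]mulrA -/(g n.+1) => h.
rewrite -h; apply/eqP; rewrite /u /v -!natr1; ring.
Qed.

(* Since [g] tends to 0, [x n := (z + n) g n] is o(n), whereas by
   [wronskian_cst] it grows like [n * wronskian 0]. *)
Let wronskian0 : wronskian 0 = 0.
Proof.
set c := wronskian 0.
pose kap := normc (z - z' - 1).
have kap0 : 0 <= kap by exact: normc_ge0.
apply: ComplexField.Normc.eq0_normc; apply/eqP; rewrite eq_le normc_ge0 andbT.
apply/ler_addgt0Pr => e e0; rewrite add0r.
(* The bound below loses (kap + 1) d per step; [kap + 2] leaves a margin of d per step, which
   eventually exceeds the constant [K]. *)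
pose d := e / (kap + 2); have d0 : 0 < d by rewrite divr_gt0// ltr_wpDl.
have de : (kap + 2) * d = e by rewrite mulrC divfK// gt_eqF// ltr_wpDl.
have [N0 _ hN] : \forall n \near \oo, normc (g n) <= d.
  move/cvgrPdist_le : f_cvg0 => /(_ d d0); apply: filterS => n.
  rewrite sub0r normrN ger0_norm ?normc_ge0// => h.
  rewrite /g ComplexField.Normc.normcM (le_trans _ h)// -[leRHS]mulr1.
  by rewrite ler_wpM2l ?normc_ge0 ?psi_le1.
pose x n := (z + n%:R) * g n.
have step n : x n.+1 = x n + c - (z - z' - 1) * g n.
  by rewrite /c -(wronskian_cst n) /x /wronskian /u /v -natr1; ring.
have close k : normc (x (N0 + k)%N - x N0 - k%:R * c) <= k%:R * (kap * d).
  elim: k => [|k IH].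
    by rewrite addn0 subrr !mul0r subrr (normc_nat 0 : normc 0 = 0).
  have -> : x (N0 + k.+1)%N - x N0 - k.+1%:R * c =
      (x (N0 + k)%N - x N0 - k%:R * c) - (z - z' - 1) * g (N0 + k)%N.
    by rewrite addnS step -natr1; ring.
  have -> : k.+1%:R * (kap * d) = k%:R * (kap * d) + kap * d by rewrite -natr1; ring.
  rewrite (le_trans (normcB _ _))// lerD//.
  rewrite ComplexField.Normc.normcM ler_wpM2l// hN//=; exact: leq_addr.
pose K := (normc z + N0%:R) * d + normc (x N0).
have bound k : k%:R * normc c <= k%:R * ((kap + 1) * d) + K.
  have -> : k%:R * normc c = normc (k%:R * c).
    by rewrite ComplexField.Normc.normcM normc_nat.
  have -> : k%:R * c = (x (N0 + k)%N - x N0) - (x (N0 + k)%N - x N0 - k%:R * c).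
    by ring.
  apply: le_trans (normcB _ _) _.
  have h1 := close k; have h2 := normcB (x (N0 + k)%N) (x N0).
  have h3 : normc (x (N0 + k)%N) <= (normc z + N0%:R + k%:R) * d.
    rewrite ComplexField.Normc.normcM ler_pM ?normc_ge0//; last first.
      by apply: hN => /=; exact: leq_addr.
    by rewrite (le_trans (normcD _ _))// normc_nat natrD addrA.
  rewrite /K; lra.
have K0 : 0 <= K.
  apply: addr_ge0; last exact: normc_ge0.
  by apply: mulr_ge0 (ltW d0); apply: addr_ge0; rewrite ?normc_ge0.
rewrite leNgt; apply/negP => ce.
have := bound (Num.truncn (K / d)).+1; set k := (Num.truncn (K / d)).+1%:R => h.
have kK : K / d < k by exact: truncnS_gt.
have {}kK : K < k * d by rewrite -ltr_pdivrMr.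
have k0 : 0 < k by rewrite ltr0n.
have : k * e < k * normc c by rewrite ltr_pM2l.
rewrite -de; lra.
Qed.

(** A zero Wronskian makes [f] proportional to [psi], so [f] inherits its first-order recurrence. *)
Let f_first_order n : alpha n * f n.+1 = v n * f n.
Proof.
have h : wronskian n = 0 by rewrite wronskian_cst wronskian0.
apply: (mulIf (psi0 n.+1)).
have e1 : alpha n * f n * psi n.+1 = v n * g n.
  rewrite /g psiS; field; exact: alpha0.
have e2 : u n * g n.+1 = v n * g n by apply/eqP; rewrite -subr_eq0; apply/eqP.
apply: (mulfI (alpha0 n)).
have -> : alpha n * (alpha n * f n.+1 * psi n.+1) = v n * (u n * g n.+1).
  rewrite /g (_ : alpha n * _ = alpha n ^+ 2 * (f n.+1 * psi n.+1)); last by ring.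
  by rewrite alpha2; ring.
rewrite e2 -e1; ring.
Qed.

Let f_growth n : n.+1%:R * sqn (f n) <= n.+2%:R * sqn (f n.+1).
Proof.
have e : normc (u n) * sqn (f n.+1) = normc (v n) * sqn (f n).
  have vp := npos (v0 n).
  apply: (mulIf (lt0r_neq0 vp)).
  have := congr1 (fun x => normc x ^+ 2) (f_first_order n).
  rewrite !ComplexField.Normc.normcM !exprMn nalpha /sqn => e.
  by rewrite mulrAC e; ring.
rewrite -(ler_pM2l (npos (u0 n))).
rewrite (_ : _ * (n.+2%:R * _) = (n.+2%:R * normc (v n)) * sqn (f n)); last first.
  by rewrite -[in RHS]mulrA -e; ring.
rewrite mulrA [normc (u n) * _]mulrC.
by rewrite ler_wpM2r ?sqn_ge0.
Qed.

(** If f 0 were nonzero, [f_growth] would give |f k|^2 >= |f 0|^2 / (k + 1), and the harmonic series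
    would be bounded. The first-order recurrence then propagates the zero. *)
Lemma half_line_recurrence_eq0 n : f n = 0.
Proof.
have f00 : f 0 = 0.
  have lower k : sqn (f 0) <= k.+1%:R * sqn (f k).
    elim: k => [|k IH]; first by rewrite mul1r.
    exact: le_trans IH (f_growth k).
  apply/eqP/negPn/negP => f0; have s0 : 0 < sqn (f 0) by rewrite exprn_gt0// npos.
  apply: (@dvg_harmonic R); case: bounded_sums => M hM.
  apply: nondecreasing_is_cvgn.
    by apply: nondecreasing_series => k _ _; rewrite harmonic_ge0.
  exists (M / sqn (f 0)) => _ [N _ <-]; rewrite ler_pdivlMr//.
  apply: le_trans (hM N); rewrite /series /= mulr_suml; apply: ler_sum => k _.
  by rewrite /harmonic ler_pdivrMl ?ltr0n.
elim: n => // n IH; apply: (mulfI (alpha0 n)).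
by rewrite f_first_order IH !mulr0.
Qed.

End HalfLineRecurrence.

(** * The gamma operator has no square summable kernel *)

Section GammaKernel.
Variable R : realType.
Local Notation C := R[i].
Local Notation normc := ComplexField.Normc.normc.
Implicit Types (z : C) (F : int -> C).

(** The coupling between sites n and n + 1: for x = n + 1/2 one has x + 1/2 = n + 1, so the coupling
    to site n - 1 is the same function at n - 1. *)
Definition offdiag z z' (n : int) : C :=
  sqrtC ((z + n%:~R + 1) * (z' + n%:~R + 1)).

Definition diag z z' (n : int) : C := z + z' + 2 * n%:~R + 1.

Lemma offdiag_sqr z z' n : offdiag z z' n ^+ 2 = (z + n%:~R + 1) * (z' + n%:~R + 1).
Proof. by rewrite /offdiag sqrtCK. Qed.

Lemma gamma_opE z z' : gamma_op z z' =
  tridiag (offdiag z z') (fun n => - diag z z' n) (fun n => offdiag z z' (n - 1)).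
Proof.
apply/funext => F; apply/funext => n; rewrite /gamma_op /tridiag /half.
have e1 (y : C) : y + (n%:~R + 2^-1) + 2^-1 = y + n%:~R + 1 by field.
have e2 (y : C) : y + (n%:~R + 2^-1) - 2^-1 = y + (n - 1)%:~R + 1.
  by rewrite rmorphB /=; field.
have e3 : z + z' + 2 * (n%:~R + 2^-1) = diag z z' n.
  by rewrite /diag; field.
by rewrite !e1 !e2 e3 mulNr.
Qed.

(** In the principal case the product is |z + n|^2 with z nonreal. In the complementary case both
    factors have the same sign, as no integer separates the two parameters. *)
Lemma series_pos z z' : principal_series z z' \/ complementary_series z z' ->
  forall n : int, 0 < (z + n%:~R) * (z' + n%:~R).
Proof.
have realn n : (n%:~R : C) = (n%:~R : R)%:C by rewrite rmorph_int.
case=> [[-> Iz]|[a [b [-> [-> [m /andP[/andP[a1 a2] /andP[b1 b2]]]]]]]] n.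
  have -> : (z + n%:~R) * (conjc z + n%:~R) = `|z + n%:~R| ^+ 2.
    rewrite sqr_normc; congr (_ * _); rewrite rmorphD /= realn.
    by case: z {Iz} => x y /=; congr (_ +i* _); rewrite oppr0.
  rewrite exprn_gt0// normr_gt0; apply: contra Iz => /eqP.
  by rewrite realn; case: z => x y [] _ /=; rewrite addr0 => ->.
rewrite realn -!rmorphD -rmorphM /= ltcR.
have [nm|nm] := leP (- m) n.
  have : 0 <= n%:~R + m%:~R :> R by rewrite -intrD ler0z addrC -lerBlDl sub0r.
  by move=> h; apply: mulr_gt0; lra.
have : n%:~R + m%:~R + 1 <= 0 :> R.
  rewrite -intrD -(intrD R _ 1) lerz0; move: nm; rewrite -lezD1; lra.
by move=> h; rewrite nmulr_rgt0; lra.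
Qed.

(** The half-line result kills [F] from [n0] upwards; downwards the recurrence is solved for F (n -
    1), its coefficient being nonzero. The origin [n0] is free so that the two modulus conditions
    can be met. *)
Lemma gamma_kernel_shifted z z' (n0 : int) F :
  (forall n : int, 0 < (z + n%:~R) * (z' + n%:~R)) ->
  (forall k : nat, normc (z' + n0%:~R + k.+1%:R) <= normc (z + n0%:~R + k.+1%:R)) ->
  (forall k : nat, k.+1%:R * normc (z + n0%:~R + k.+1%:R) <=
     k.+2%:R * normc (z' + n0%:~R + k.+1%:R)) ->
  ell2 F -> gamma_op z z' F = (fun=> 0) -> F = (fun=> 0).
Proof.
move=> pos vu uv lF; rewrite gamma_opE => DF.
have shift (y : C) k : y + (n0 + k%:Z)%:~R + 1 = y + n0%:~R + k.+1%:R.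
  by rewrite rmorphD /= -natr1 -pmulrn; ring.
have nz k : z + n0%:~R + k.+1%:R != 0 /\ z' + n0%:~R + k.+1%:R != 0.
  have := lt0r_neq0 (pos (n0 + k.+1%:Z)); rewrite mulf_eq0 negb_or => /andP[].
  by rewrite rmorphD /= !addrA.
have rec n : offdiag z z' n * F (n + 1) - diag z z' n * F n +
    offdiag z z' (n - 1) * F (n - 1) = 0.
  by have := congr1 (@^~ n) DF; rewrite /tridiag mulNr.
have up k : F (n0 + k%:Z) = 0.
  apply: (@half_line_recurrence_eq0 R (z + n0%:~R) (z' + n0%:~R)
    (fun k => offdiag z z' (n0 + k%:Z)) (fun k => F (n0 + k%:Z))) => //.
  - by move=> n; rewrite offdiag_sqr !shift.
  - by move=> n; case: (nz n).
  - by move=> n; case: (nz n).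
  - move=> n; have := rec (n0 + n.+1%:Z).
    have -> : n0 + n.+1%:Z + 1 = n0 + n.+2%:Z by rewrite -addrA -PoszD addn1.
    have -> : n0 + n.+1%:Z - 1 = n0 + n%:Z by rewrite -addn1 PoszD addrA addrK.
    have -> // : diag z z' (n0 + n.+1%:Z) =
      z + n0%:~R + n.+2%:R + (z' + n0%:~R + n.+1%:R).
    rewrite /diag rmorphD /= -!natr1 -pmulrn -natr1; ring.
  - exists (fine (psum (fun n => sqn (F n)))) => N.
    rewrite -lee_fin fineK; last by apply: fin_psum => // n; exact: sqn_ge0.
    by apply: sum_le_psum => n; exact: sqn_ge0.
have off n : offdiag z z' n != 0.
  rewrite -sqrf_eq0 offdiag_sqr; have := lt0r_neq0 (pos (n + 1)).
  by rewrite rmorphD /= !addrA.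
have down k : F (n0 - k%:Z) = 0 /\ F (n0 - k%:Z + 1) = 0.
  elim: k => [|k [IH1 IH2]].
    by rewrite subr0; split; [have := up 0%N; rewrite addr0|exact: (up 1%N)].
  have e : n0 - k.+1%:Z = n0 - k%:Z - 1 by rewrite -addn1 PoszD opprD addrA.
  rewrite e subrK; split => //.
  have := rec (n0 - k%:Z); rewrite IH1 IH2 !mulr0 subr0 add0r => /eqP.
  by rewrite mulf_eq0 (negbTE (off _)) => /eqP.
apply/funext => n; have [h|h] := leP n0 n.
  have -> : n = n0 + `|(n - n0)%R|%N%:Z.
    by rewrite gez0_abs ?subr_ge0// [RHS]addrC subrK.
  exact: up.
have -> : n = n0 - `|(n0 - n)%R|%N%:Z.
  by rewrite gez0_abs ?subr_ge0 ?(ltW h)// opprB [RHS]addrC subrK.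
by case: (down `|(n0 - n)%R|%N).
Qed.

Lemma gamma_opC z z' : gamma_op z z' = gamma_op z' z.
Proof.
rewrite !gamma_opE; have e : offdiag z z' = offdiag z' z.
  by apply/funext => n; rewrite /offdiag mulrC.
by rewrite e; congr tridiag; apply/funext => n; rewrite /diag (addrC z).
Qed.

Lemma gamma_kernel z z' F : principal_series z z' \/ complementary_series z z' ->
  ell2 F -> gamma_op z z' F = (fun=> 0) -> F = (fun=> 0).
Proof.
move=> hz; have pos := series_pos hz; case: hz => [[z'E Iz]|].
  have e k : normc (z' + 0%:~R + k.+1%:R) = normc (z + 0%:~R + k.+1%:R).
    rewrite z'E (_ : k.+1%:R = (k.+1%:R : R)%:C); last by rewrite rmorph_nat.
    by case: z {z'E Iz pos} => x y /=; rewrite !addr0 sqrrN.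
  apply: (@gamma_kernel_shifted z z' 0) => // k; rewrite e//.
  by rewrite ler_wpM2r ?normc_ge0// ler_nat.
(* By symmetry the larger parameter is put in the role of z, and the origin -m brings both
   parameters into (0, 1). *)
move=> [a [b [za [z'b [m /andP[am bm]]]]]].
wlog ba : z z' a b za z'b am bm pos / b <= a.
  move=> wl lF; have [ba|/ltW ab] := leP b a; first exact: (wl z z' a b).
  by rewrite gamma_opC; apply: (wl z' z b a) => // n; rewrite mulrC.
move=> lF; have real (x : R) k : normc (x%:C + (- m)%:~R + k.+1%:R) =
    `|x - m%:~R + k.+1%:R|.
  rewrite (_ : k.+1%:R = (k.+1%:R : R)%:C); last by rewrite rmorph_nat.
  rewrite (_ : (- m)%:~R = (- m%:~R : R)%:C); last by rewrite -intrN rmorph_int.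
  by rewrite /= !addr0 expr0n addr0 sqrtr_sqr.
have [am1 am2] := andP am; have [bm1 bm2] := andP bm.
have pa (k : nat) : `|a - m%:~R + k.+1%:R| = a - m%:~R + k.+1%:R.
  by rewrite ger0_norm// addr_ge0// subr_ge0 ltW.
have pb (k : nat) : `|b - m%:~R + k.+1%:R| = b - m%:~R + k.+1%:R.
  by rewrite ger0_norm// addr_ge0// subr_ge0 ltW.
apply: (@gamma_kernel_shifted z z' (- m)) => // k; rewrite za z'b !real pa pb.
  lra.
have k0 : 0 <= k%:R :> R by [].
rewrite -[k.+2%:R]natr1 -[k.+1%:R]natr1.
(* The difference of the two sides is exactly (k + 2)(b - m) + (k + 1)(m + 1 - a). *)
have : 0 <= (k%:R + 1 + 1) * (b - m%:~R) by apply: mulr_ge0; lra.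
have : 0 <= (k%:R + 1) * (m%:~R + 1 - a) by apply: mulr_ge0; lra.
lra.
Qed.

End GammaKernel.

(** * Strong convergence of spectral projections *)

Section StrongConvergence.
Variable R : realType.
Local Notation C := R[i].
Local Notation T := (measurableTypeR R).
Local Notation nrm := (@ell2_norm R).
Variables (I : Type) (F : set_system I).
Hypothesis FF : Filter F.
Variables (p q r : int -> C) (pt qt rt : I -> int -> C).
Local Notation D := (tridiag p q r).
Local Notation Dt := (fun t => tridiag (pt t) (qt t) (rt t)).
Hypothesis D_cvg : forall w, finsupp w -> forall e : R, 0 < e ->
  \forall t \near F, nrm (fun n => Dt t w n - D w n) < e.
Local Notation G := (op_closure D).
Implicit Types (f g u w : int -> C) (S B : set T).

Lemma closure_ell2 (A : (int -> C) -> int -> C) f g :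
  op_closure A (f, g) -> ell2 f /\ ell2 g.
Proof. by case=> ? []. Qed.

(* If [Dt t w] is close to [lam * w] and [Q := E S], then pairing with [Q w]
   gives [s * lam * |Q w|^2 <= |Dt t w - lam * w| * |Q w|], because
   [s * <Dt t w, Q w> <= 0]. *)
Lemma pvm_small_of_approx_eigenvector S u g (s lam K e : R) : measurable S ->
  `|s| = 1 -> (forall x, S x -> s * x <= 0) -> 0 < s * lam -> 0 < e ->
  G (u, g) -> nrm (fun n => g n - lam%:C * u n) <= K ->
  \forall t \near F, forall E, is_spectral_resolution (op_closure (Dt t)) E ->
    nrm (E S u) <= K / (s * lam) + e.
Proof.
move=> mS s1 Ss c0 e0 Gu gK; have [lu lg] := closure_ell2 Gu.
set c := s * lam in c0 *; have cE : `|lam| = c.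
  by rewrite -[LHS]mul1r -s1 -normrM gtr0_norm.
(* Error budget: 2 d + c d in the bound on [h], and another c d when passing from [w] back to [u],
   for a total of e c. *)
pose d := e * c / (2 + 2 * c).
have c2 : 0 < 2 + 2 * c by lra.
have d0 : 0 < d by rewrite /d !divr_gt0// mulr_gt0.
have dE : 2 * d + 2 * (c * d) = e * c.
  by rewrite -[RHS](@divfK _ (2 + 2 * c)) ?gt_eqF// -/d; ring.
have [_ [_ /(_ d d0) [w [fw [/= uw gw]]]]] := Gu.
have lw := ell2_finsupp fw; have lDw := ell2_finsupp (finsupp_tridiag p q r fw).
apply: filterS (D_cvg fw d0) => t wt E hE; have hP : is_pvm E by case: hE.
have lDt := ell2_finsupp (finsupp_tridiag (pt t) (qt t) (rt t) fw).
have lQu := ell2_pvm hP mS lu; have lQw := ell2_pvm hP mS lw.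
have Gw : op_closure (Dt t) (w, Dt t w) by exact: closure_core.
have sgn := graph_sign hE (@closure_ell2 _) (@closure_lin _ _ _ _) mS Ss Gw.
pose h n := Dt t w n - lam%:C * w n.
have llw := ell2Z lam%:C lw; have llu := ell2Z lam%:C lu.
have lh : ell2 h by exact: ell2B.
have hle : nrm h <= d + d + K + c * d.
  have l1 := ell2B lDt lDw; have l2 := ell2B lDw lg; have l3 := ell2B lg llu.
  have l4 := ell2Z lam%:C (ell2B lu lw).
  have -> : h = (fun n => ((Dt t w n - D w n) + (D w n - g n) +
      (g n - lam%:C * u n)) + lam%:C * (u n - w n)).
    by apply/funext => n; rewrite /h; ring.
  apply: le_trans (nrmD (ell2D (ell2D l1 l2) l3) l4) _; apply: lerD.
    apply: le_trans (nrmD (ell2D l1 l2) l3) _; apply: lerD => //.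
    apply: le_trans (nrmD l1 l2) _; apply: lerD; first exact: ltW.
    by rewrite nrmBC ltW.
  by rewrite (nrmZ _ (ell2B lu lw)) cE ler_wpM2l ?ltW.
have Qw : c * nrm (E S w) <= nrm h.
  have e1 : rdot (Dt t w) (E S w) = rdot h (E S w) + lam * nrm (E S w) ^+ 2.
    have DwE : Dt t w = (fun n => h n + lam%:C * w n).
      by apply/funext => n; rewrite /h subrK.
    by rewrite [in LHS]DwE (rdotDl lh llw lQw) (rdotZl lam lw lQw) (rdotC w) (pvm_rdot hP mS lw).
  have e2 : - (s * rdot h (E S w)) <= nrm h * nrm (E S w).
    apply: le_trans (ler_norm _) _; rewrite normrN normrM s1 mul1r ler_norml.
    rewrite rdot_le// andbT lerNl -(rdotNl lh lQw).
    by rewrite (le_trans (rdot_le (ell2N lh) lQw))// nrmN.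
  have [->|n0] := eqVneq (nrm (E S w)) 0; first by rewrite mulr0 nrm_ge0.
  have np : 0 < nrm (E S w) by rewrite lt_def n0 nrm_ge0.
  rewrite -(ler_pM2r np); move: sgn; rewrite e1 mulrDr mulrA -/c expr2 mulrA; lra.
have Qu : nrm (E S u) <= nrm (E S w) + d.
  have -> : E S u = (fun n => E S w n + E S (fun n => u n - w n) n).
    by rewrite (pvmB hP mS lu lw); apply/funext => n; rewrite addrC subrK.
  have lE := ell2_pvm hP mS (ell2B lu lw).
  apply: le_trans (nrmD lQw lE) _; rewrite lerD2l.
  exact: le_trans (pvm_le hP mS (ell2B lu lw)) (ltW uw).
rewrite -(ler_pM2r c0) mulrDl divfK ?gt_eqF// -dE.
have := ler_wpM2r (ltW c0) Qu; lra.
Qed.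

Variable E : set T -> (int -> C) -> (int -> C).
Hypothesis hE : is_spectral_resolution G E.
Let hP : is_pvm E. Proof. by case: hE. Qed.
Variables (S : set T) (s : R).
Hypothesis mS : measurable S.
Hypothesis s1 : `|s| = 1.
Hypothesis Ss : forall x, S x -> s * x <= 0.

(** Half-open, so that bisection at the midpoint gives an exact partition. *)
Definition itv_oc (x y : R) : set T := [set` `]x, y]].

Lemma measurable_itv_oc x y : measurable (itv_oc x y).
Proof. exact: measurable_itv. Qed.

Lemma itv_oc_le x y t : itv_oc x y t -> x <= t <= y.
Proof. by rewrite /itv_oc /= in_itv /= => /andP[/ltW -> ->]. Qed.

(* Bisection: each half [u1], [u2] of [u] has half the spectral width, while
   orthogonality gives [|u1| + |u2| <= sqrt 2 * |u| <= 3 / 2 * |u|]. *)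
Lemma pvm_interval_small k (x y c e : R) u : x <= y -> 0 < c -> 0 < e ->
  (forall t, x <= t <= y -> c <= s * t) -> ell2 u -> E (itv_oc x y) u = u ->
  \forall t \near F, forall E', is_spectral_resolution (op_closure (Dt t)) E' ->
    nrm (E' S u) <= (y - x) / c * (3 / 4) ^+ k * nrm u + e.
Proof.
move=> xy c0 e0 sc lu Eu; elim: k => [|k IH] in x y u e xy e0 sc lu Eu *.
  have [g Gu gx] := approx_eigenvector hE (@closure_ell2 _) (@closure_lin _ _ _ _)
    (@measurable_itv_oc x y) xy (@itv_oc_le x y) lu Eu.
  have sx : c <= s * x by apply: sc; rewrite lexx.
  have sx0 := lt_le_trans c0 sx.
  apply: filterS (pvm_small_of_approx_eigenvector mS s1 Ss sx0 e0 Gu gx) => t h E' hE'.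
  apply: le_trans (h E' hE') _; rewrite lerD2r expr0 mulr1 [leRHS]mulrAC ler_wpM2l//.
    by rewrite mulr_ge0 ?nrm_ge0// subr_ge0.
  by rewrite lef_pV2// posrE.
pose m := (x + y) / 2.
have xm : x <= m by rewrite /m; lra.
have my : m <= y by rewrite /m; lra.
pose u1 := E (itv_oc x m) u; pose u2 := E (itv_oc m y) u.
have mx := @measurable_itv_oc x m; have myy := @measurable_itv_oc m y.
have l1 : ell2 u1 by exact: ell2_pvm. have l2 : ell2 u2 by exact: ell2_pvm.
have e2 : 0 < e / 2 by rewrite divr_gt0.
have uE : itv_oc x y = itv_oc x m `|` itv_oc m y.
  apply/seteqP; split => t; rewrite /itv_oc /= !in_itv /=.
    by move=> /andP[? ?]; have [?|?] := leP t m; [left|right]; apply/andP; split.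
  by move=> [] /andP[? ?]; apply/andP; split => //; lra.
have disj : itv_oc x m `&` itv_oc m y = set0.
  apply/seteqP; split => t //; rewrite /itv_oc /= !in_itv /=.
  by move=> [/andP[? ?] /andP[? ?]]; lra.
have u12 : u = (fun n => u1 n + u2 n) by rewrite -[LHS]Eu uE (pvmU hP mx myy disj lu).
have sum2 : nrm u1 ^+ 2 + nrm u2 ^+ 2 <= nrm u ^+ 2.
  rewrite (pvm_pythagoras hP mx lu) lerD2l ler_pXn2r// ?nnegrE ?nrm_ge0//.
  apply: (pvm_le_subset hP myy (measurableC mx) lu).
  by apply/disjoints_subset; rewrite setIC.
have sc1 t : x <= t <= m -> c <= s * t.
  by move=> /andP[xt tm]; apply: sc; rewrite xt (le_trans tm).
have sc2 t : m <= t <= y -> c <= s * t.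
  by move=> /andP[mt ty]; apply: sc; rewrite ty (le_trans xm).
apply: filterS2 (IH x m u1 (e / 2) xm e2 sc1 l1 (pvm_idem hP mx lu))
  (IH m y u2 (e / 2) my e2 sc2 l2 (pvm_idem hP myy lu)) => t h1 h2 E' hE'.
have {}h1 := h1 E' hE'; have {}h2 := h2 E' hE'; have hP' : is_pvm E' by case: hE'.
rewrite [in leLHS]u12 (pvmD hP' mS l1 l2).
apply: le_trans (nrmD (ell2_pvm hP' mS l1) (ell2_pvm hP' mS l2)) _.
apply: le_trans (lerD h1 h2) _.
(* Half the width times the factor 3 / 2 from [avg] accounts for the ratio 3 / 4; the two errors e /
   2 add up to e. *)
have -> : m - x = (y - x) / 2 by rewrite /m; field.
have -> : y - m = (y - x) / 2 by rewrite /m; field.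
rewrite exprS; set q0 := (3 / 4) ^+ k; set Q := (y - x) / c * q0.
have Q0 : 0 <= Q.
  by rewrite !mulr_ge0 ?subr_ge0 ?invr_ge0 ?(ltW c0)// exprn_ge0// divr_ge0.
have avg : nrm u1 + nrm u2 <= 3 / 2 * nrm u.
  rewrite -(@ler_pXn2r _ 2)// ?nnegrE ?addr_ge0 ?mulr_ge0 ?nrm_ge0 ?divr_ge0//.
  have := sqr_ge0 (nrm u1 - nrm u2); have := sqr_ge0 (nrm u); lra.
have := ler_wpM2l Q0 avg.
have -> : (y - x) / 2 / c * q0 * nrm u1 + e / 2 + ((y - x) / 2 / c * q0 * nrm u2 + e / 2) =
  (Q * (nrm u1 + nrm u2)) / 2 + e by rewrite /Q; field; rewrite gt_eqF.
have -> : (y - x) / c * (3 / 4 * q0) * nrm u = Q * (3 / 4 * nrm u).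
  by rewrite /Q; field; rewrite gt_eqF.
lra.
Qed.

(** The number of bisections depends only on the interval, [u], [c] and [e], so it is fixed before
    the parameter approaches its limit. *)
Lemma pvm_interval_cvg0 (x y c e : R) u : x <= y -> 0 < c -> 0 < e ->
  (forall t, x <= t <= y -> c <= s * t) -> ell2 u -> E (itv_oc x y) u = u ->
  \forall t \near F, forall E', is_spectral_resolution (op_closure (Dt t)) E' ->
    nrm (E' S u) <= e.
Proof.
move=> xy c0 e0 sc lu Eu; have e2 : 0 < e / 2 by rewrite divr_gt0.
pose M := (y - x) / c * nrm u + 1.
have M0 : 0 < M.
  by rewrite ltr_wpDl// !mulr_ge0 ?nrm_ge0 ?subr_ge0 ?invr_ge0 ?(ltW c0).
have [k hk] : exists k, (3 / 4 : R) ^+ k <= e / 2 / M.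
  have /cvgrPdist_le /(_ _ (divr_gt0 e2 M0)) [k _ hk] :
      (fun n => (3 / 4 : R) ^+ n) @ \oo --> (0 : R).
    by apply: cvg_expr; rewrite ger0_norm ?divr_ge0//; lra.
  exists k; have := hk k (leqnn k).
  by rewrite sub0r normrN ger0_norm// exprn_ge0// divr_ge0.
apply: filterS (pvm_interval_small k xy c0 e2 sc lu Eu) => t h E' hE'.
apply: le_trans (h E' hE') _.
suff : (y - x) / c * (3 / 4) ^+ k * nrm u <= e / 2 by lra.
rewrite mulrAC; have q0 : 0 <= (3 / 4 : R) ^+ k by rewrite exprn_ge0// divr_ge0.
apply: (@le_trans _ _ (M * (3 / 4) ^+ k)); first by rewrite ler_wpM2r// /M; lra.
by rewrite mulrC -ler_pdivlMr.
Qed.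

(** Compact exhaustion of an open half-line: the part of [f] with spectrum in [B] outside the k-th
    interval is small by [pvm_cap_cvg], and projections do not enlarge it. The sign [s] lets one
    argument serve both half-lines. *)
Lemma pvm_half_line_cvg0 (B : set T) (x y : nat -> R) (c : nat -> R) f (e : R) :
  measurable B -> (forall k, x k <= y k) -> (forall k, 0 < c k) ->
  (forall k t, x k <= t <= y k -> c k <= s * t) ->
  (forall k, itv_oc (x k) (y k) `<=` B) ->
  {homo (fun k => itv_oc (x k) (y k)) : n m / (n <= m)%N >-> n `<=` m} ->
  B `<=` \bigcup_k itv_oc (x k) (y k) -> ell2 f -> 0 < e ->
  \forall t \near F, forall E', is_spectral_resolution (op_closure (Dt t)) E' ->
    nrm (E' S (E B f)) <= e.
Proof.
move=> mB xy c0 sc JB Jmono BJ lf e0; have e2 : 0 < e / 2 by rewrite divr_gt0.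
pose J k := itv_oc (x k) (y k); have mJ k : measurable (J k) by exact: measurable_itv_oc.
have mBJ k : measurable (B `\` J k) by exact: measurableD.
have h : nrm (E (B `\` J k) f) @[k --> \oo] --> (0 : R).
  apply: (pvm_cap_cvg hP lf mBJ).
    by move=> n m nm t [Bt nJ]; split => // Jn; apply: nJ; exact: Jmono Jn.
  apply/seteqP; split => // t h; have [Bt _] := h 0%N Logic.I.
  by have [k _ Jt] := BJ t Bt; have [_] := h k Logic.I.
move/cvgrPdist_le : h => /(_ _ e2) [k _ /(_ k (leqnn k))].
rewrite sub0r normrN ger0_norm ?nrm_ge0// => hk.
have lJ := ell2_pvm hP (mJ k) lf; have lBJ := ell2_pvm hP (mBJ k) lf.
have split : E B f = (fun n => E (J k) f n + E (B `\` J k) f n).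
  rewrite -(pvmU hP (mJ k) (mBJ k) _ lf); last by rewrite setDE setICA setICr setI0.
  by rewrite setDUK//; exact: JB.
apply: filterS (pvm_interval_cvg0 (xy k) (c0 k) e2 (sc k) lJ (pvm_idem hP (mJ k) lf)).
move=> t h E' hE'; have {}h := h E' hE'; have hP' : is_pvm E' by case: hE'.
rewrite split (pvmD hP' mS lJ lBJ).
apply: le_trans (nrmD (ell2_pvm hP' mS lJ) (ell2_pvm hP' mS lBJ)) _.
have := pvm_le hP' mS lBJ; lra.
Qed.
End StrongConvergence.

(** * Convergence of the hypergeometric operators on the core, and the null spectral projection *)

Section HypergeometricGamma.
Variable R : realType.
Local Notation C := R[i].
Local Notation T := (measurableTypeR R).
Local Notation nrm := (@ell2_norm R).
Implicit Types (f g u w : int -> C).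

Definition diag_xi (z z' : C) (xi : R) (n : int) : C :=
  half R n + xi%:C * (z + z' + half R n).

Lemma hypergeom_opE (z z' : C) xi : 0 < xi ->
  (forall n : int, 0 < (z + n%:~R) * (z' + n%:~R)) ->
  hypergeom_op z z' xi = tridiag (fun n => (Num.sqrt xi)%:C * offdiag z z' n)
    (fun n => - diag_xi z z' xi n)
    (fun n => (Num.sqrt xi)%:C * offdiag z z' (n - 1)).
Proof.
move=> xi0 pos; apply/funext => f; apply/funext => n.
rewrite /hypergeom_op /tridiag -/(diag_xi z z' xi n) /half.
have e1 (y : C) : y + (n%:~R + 2^-1) + 2^-1 = y + n%:~R + 1 by field.
have e2 (y : C) : y + (n%:~R + 2^-1) - 2^-1 = y + (n - 1)%:~R + 1.
  by rewrite rmorphB /=; field.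
have sq m : sqrtC (xi%:C * (z + m%:~R + 1) * (z' + m%:~R + 1)) =
    (Num.sqrt xi)%:C * offdiag z z' m.
  have p0 : 0 <= (z + m%:~R + 1) * (z' + m%:~R + 1).
    by have := pos (m + 1); rewrite rmorphD /= !addrA => /ltW.
  rewrite -mulrA -[xi in LHS](sqr_sqrtr (ltW xi0)) rmorphXn /= -(offdiag_sqr z z' m).
  rewrite -exprMn sqrCK// mulr_ge0//; first by rewrite lecR sqrtr_ge0.
  by rewrite sqrtC_ge0.
by rewrite !e1 !e2 !sq mulNr.
Qed.

(** The difference equals (sqrt xi - 1) U + (1 - xi) V with [U] and [V] finitely supported and
    independent of [xi], so both coefficients tending to 0 is enough. *)
Lemma hypergeom_op_cvg (z z' : C) w :
  (forall n : int, 0 < (z + n%:~R) * (z' + n%:~R)) ->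
  finsupp w -> forall e : R, 0 < e ->
  \forall xi \near (1 : R)^'-,
    nrm (fun n => hypergeom_op z z' xi w n - gamma_op z z' w n) < e.
Proof.
move=> pos fw e e0.
pose U := tridiag (offdiag z z') (fun=> 0) (fun n => offdiag z z' (n - 1)) w.
pose V := tridiag (fun=> 0) (fun n => z + z' + half R n) (fun=> 0) w.
have lU : ell2 U by apply: ell2_finsupp; exact: finsupp_tridiag.
have lV : ell2 V by apply: ell2_finsupp; exact: finsupp_tridiag.
pose M := nrm U + nrm V + 1.
have M0 : 0 < M by rewrite ltr_wpDl// addr_ge0 ?nrm_ge0.
have d1 : 1 - e / M < 1 by rewrite gtrBl divr_gt0.
near=> xi.
have xi0 : 0 < xi by near: xi; exact: nbhs_left_gt.
have xi1 : xi < 1 by near: xi; exact: nbhs_left_lt.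
have xie : 1 - e / M < xi by near: xi; exact: nbhs_left_gt.
have -> : (fun n => hypergeom_op z z' xi w n - gamma_op z z' w n) =
    (fun n => (Num.sqrt xi - 1)%:C * U n + (1 - xi)%:C * V n).
  apply/funext => n; rewrite (hypergeom_opE xi0 pos) gamma_opE /tridiag /U /V /tridiag.
  by rewrite /diag_xi /diag !rmorphB /= /half; field.
have lU1 := ell2Z (Num.sqrt xi - 1)%:C lU; have lV1 := ell2Z (1 - xi)%:C lV.
apply: le_lt_trans (nrmD lU1 lV1) _; rewrite !nrmZ//.
(* On [0, 1] one has xi <= sqrt xi <= 1. *)
have s1 : `|Num.sqrt xi - 1| <= 1 - xi.
  have h0 := sqrtr_ge0 xi; have h2 := sqr_sqrtr (ltW xi0).
  have h1 : Num.sqrt xi <= 1 by rewrite -[leRHS]sqrtr1 ler_wsqrtr// ltW.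
  rewrite ler0_norm ?subr_le0//; rewrite -{2}h2.
  have : 0 <= Num.sqrt xi * (1 - Num.sqrt xi) by rewrite mulr_ge0// subr_ge0.
  lra.
have s2 : `|1 - xi| = 1 - xi by rewrite ger0_norm// subr_ge0 ltW.
rewrite s2; apply: le_lt_trans (lerD (ler_wpM2r (nrm_ge0 U) s1) (lexx _)) _.
have : (1 - xi) * M < e by rewrite -ltr_pdivlMr//; lra.
rewrite /M; lra.
Unshelve. all: by end_near. Qed.

(** Applied to an interval of width zero, [approx_eigenvector] puts the range of this projection in
    the kernel of the operator. *)
Lemma gamma_pvm0 (z z' : C) E f : principal_series z z' \/ complementary_series z z' ->
  is_spectral_resolution (op_closure (gamma_op z z')) E -> ell2 f ->
  E [set 0 : T] f = (fun=> 0).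
Proof.
move=> hz hE lf; have hP : is_pvm E by case: hE.
have m0 : measurable [set 0 : T] by exact: measurable_set1.
have l0 := ell2_pvm hP m0 lf.
move: hE; rewrite gamma_opE => hE.
have in0 (x : T) : [set 0 : T] x -> (0 : R) <= x <= 0 by move=> ->; rewrite lexx.
have [g Gg] := approx_eigenvector hE (@closure_ell2 _ _) (@closure_lin _ _ _ _) m0
  (lexx 0) in0 l0 (pvm_idem hP m0 lf).
have [_ lg] := closure_ell2 Gg.
rewrite subrr mul0r; under eq_fun do rewrite mul0r subr0; move=> g0.
apply: (gamma_kernel hz l0); rewrite gamma_opE (closure_tridiag Gg).
by apply: nrm_eq0 => //; apply/eqP; rewrite eq_le g0 nrm_ge0.
Qed.

End HypergeometricGamma.

(** * Strong convergence of the positive spectral projections *)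

Theorem corollary5p4 (R : realType) (z z' : R[i])
  (hz : principal_series z z' \/ complementary_series z z')
  (P : R -> (int -> R[i]) -> (int -> R[i]))
  (hP : forall xi : R, 0 < xi < 1 ->
    is_Proj_plus (op_closure (hypergeom_op z z' xi)) (P xi))
  (Pgamma : (int -> R[i]) -> (int -> R[i]))
  (hPgamma : is_Proj_plus (op_closure (gamma_op z z')) Pgamma) :
  strong_cvg (1 : R)^'- P Pgamma.
Proof.
have pos := series_pos hz.
pose pt (xi : R) n := (Num.sqrt xi)%:C * offdiag z z' n.
pose qt (xi : R) n := - diag_xi z z' xi n.
pose rt (xi : R) n := (Num.sqrt xi)%:C * offdiag z z' (n - 1).
have D_cvg w : finsupp w -> forall e : R, 0 < e -> \forall xi \near (1 : R)^'-,
    ell2_norm (fun n => tridiag (pt xi) (qt xi) (rt xi) w n -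
      tridiag (offdiag z z') (fun n => - diag z z' n)
        (fun n => offdiag z z' (n - 1)) w n) < e.
  move=> fw e e0; near=> xi; have xi0 : 0 < xi by near: xi; exact: nbhs_left_gt.
  rewrite -gamma_opE -(hypergeom_opE xi0 pos).
  by near: xi; exact: hypergeom_op_cvg.
case: hPgamma => E hE PE f lf; have hpvm : is_pvm E by case: hE.
have hE' := hE; rewrite gamma_opE in hE'.
pose Bp : set (measurableTypeR R) := `]0, +oo[%classic.
pose Bm : set (measurableTypeR R) := `]-oo, 0[%classic.
have mBp : measurable Bp by exact: measurable_itv.
have mBm : measurable Bm by exact: measurable_itv.
have m0 : measurable [set 0 : measurableTypeR R] by exact: measurable_set1.
have lp := ell2_pvm hpvm mBp lf; have lm := ell2_pvm hpvm mBm lf.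
have fE : f = (fun n => E Bp f n + E Bm f n).
  have U0 : setT = (Bp `|` Bm) `|` [set 0].
    apply/seteqP; split => // x _; rewrite /Bp /Bm /= !in_itv /= andbT.
    by have [?|?|->] := ltgtP x (0 : R); [left; right|left; left|right].
  have d1 : Bp `&` Bm = set0.
    apply/seteqP; split => // x; rewrite /Bp /Bm /= !in_itv /= andbT => -[h1 h2].
    by have := lt_trans h1 h2; rewrite ltxx.
  have d2 : (Bp `|` Bm) `&` [set 0] = set0.
    apply/seteqP; split => // x [+ x0]; rewrite {}x0 /Bp /Bm /= !in_itv /= ltxx.
    by case.
  have mU : measurable (Bp `|` Bm) by exact: measurableU.
  rewrite -[LHS](pvmT hpvm lf) U0 (pvmU hpvm mU m0 d2 lf) (gamma_pvm0 hz hE lf).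
  by under eq_fun do rewrite addr0; rewrite (pvmU hpvm mBp mBm d1 lf).
(* The intervals ]1 / (k + 1), k + 1] exhaust ]0, +oo[ while staying away from 0; their mirror
   images exhaust the negative half-line. *)
pose ord k : R := k.+1%:R.
have ord_gt0 k : 0 < ord k by rewrite ltr0n.
have ordV_gt0 k : 0 < (ord k)^-1 by rewrite invr_gt0.
have ordV_le k : (ord k)^-1 <= ord k.
  apply: (@le_trans _ _ 1); last by rewrite ler1n.
  by rewrite invf_le1// ler1n.
have ord_mono n m : (n <= m)%N -> ord n <= ord m /\ (ord m)^-1 <= (ord n)^-1.
  by move=> nm; split; [rewrite ler_nat | rewrite lef_pV2 ?posrE// ler_nat].
have exhaust (x : R) : 0 < x -> exists k, (ord k)^-1 < x /\ x < ord k.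
  move=> x0; pose k := (Num.truncn x + Num.truncn x^-1)%N; exists k; split.
    rewrite invf_plt ?posrE//; apply: lt_le_trans (truncnS_gt _) _.
    by rewrite ler_nat ltnS leq_addl.
  by apply: lt_le_trans (truncnS_gt _) _; rewrite ler_nat ltnS leq_addr.
have mBpC : measurable (~` Bp) by exact: measurableC.
(* The neighbourhood of 1 is found before any resolution at [xi] is given, hence the uniformity over
   all resolutions. *)
have small_p e : 0 < e -> \forall xi \near (1 : R)^'-, forall E',
    is_spectral_resolution (op_closure (tridiag (pt xi) (qt xi) (rt xi))) E' ->
    ell2_norm (E' (~` Bp) (E Bp f)) <= e.
  move=> e0.
  apply: (@pvm_half_line_cvg0 R R _ _ _ _ _ _ _ _ D_cvg E hE' (~` Bp) 1 mBpC _ _ Bp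
    (fun k => (ord k)^-1) ord (fun k => (ord k)^-1)) => //.
  - by rewrite normr1.
  - by move=> x; rewrite /Bp /= in_itv /= andbT mul1r => /negP; rewrite -leNgt.
  - by move=> k t /andP[h _]; rewrite mul1r.
  - move=> k t; rewrite /itv_oc /Bp /= !in_itv /= andbT => /andP[h _].
    exact: lt_trans h.
  - move=> n m /ord_mono [h1 h2] t; rewrite /itv_oc /= !in_itv /= => /andP[h3 h4].
    by rewrite (le_lt_trans h2 h3) (le_trans h4 h1).
  - move=> t; rewrite /Bp /= in_itv /= andbT => /exhaust[k [h1 h2]]; exists k => //.
    by rewrite /itv_oc /= in_itv /= h1 ltW.
have small_m e : 0 < e -> \forall xi \near (1 : R)^'-, forall E',
    is_spectral_resolution (op_closure (tridiag (pt xi) (qt xi) (rt xi))) E' ->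
    ell2_norm (E' Bp (E Bm f)) <= e.
  move=> e0.
  apply: (@pvm_half_line_cvg0 R R _ _ _ _ _ _ _ _ D_cvg E hE' Bp (-1) mBp _ _ Bm
    (fun k => - ord k) (fun k => - (ord k)^-1) (fun k => (ord k)^-1)) => //.
  - by rewrite normrN1.
  - by move=> x; rewrite /Bp /= in_itv /= andbT mulN1r oppr_le0 => /ltW.
  - by move=> k; rewrite lerN2.
  - by move=> k t /andP[_ h]; rewrite mulN1r lerNr.
  - move=> k t; rewrite /itv_oc /Bm /= !in_itv /= => /andP[_ h].
    by rewrite (le_lt_trans h)// oppr_lt0.
  - move=> n m /ord_mono [h1 h2] t; rewrite /itv_oc /= !in_itv /= => /andP[h3 h4].
    by rewrite (le_lt_trans _ h3) ?lerN2// (le_trans h4)// lerN2.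
  - move=> t; rewrite /Bm /= in_itv /= -oppr_gt0 => /exhaust[k [h1 h2]]; exists k => //.
    by rewrite /itv_oc /= in_itv /= ltrNl h2 lerNr ltW.
apply/cvgrPdist_le => e e0; have e2 : 0 < e / 2 by rewrite divr_gt0.
near=> xi.
have xi0 : 0 < xi by near: xi; exact: nbhs_left_gt.
have xi1 : xi < 1 by near: xi; exact: nbhs_left_lt.
have [E' hE'' PE'] : is_Proj_plus (op_closure (hypergeom_op z z' xi)) (P xi).
  by apply: hP; rewrite xi0.
have hpvm' : is_pvm E' by case: hE''.
rewrite (hypergeom_opE xi0 pos) in hE''.
have h1 : ell2_norm (E' (~` Bp) (E Bp f)) <= e / 2.
  by move: E' hE'' {PE' hpvm'}; near: xi; exact: small_p.
have h2 : ell2_norm (E' Bp (E Bm f)) <= e / 2.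
  by move: E' hE'' {PE' hpvm' h1}; near: xi; exact: small_m.
rewrite sub0r normrN ger0_norm ?nrm_ge0//.
rewrite (PE' f lf) (PE f lf) -/Bp.
have l1 := ell2_pvm hpvm' mBp lm; have l2 := ell2_pvm hpvm' mBpC lp.
(* Only spectral parts of the wrong sign remain: negative parts seen by the positive projection, and
   positive parts missed by it. *)
have -> : (fun n => E' Bp f n - E Bp f n) =
    (fun n => E' Bp (E Bm f) n - E' (~` Bp) (E Bp f) n).
  have -> : E' Bp f = (fun n => E' Bp (E Bp f) n + E' Bp (E Bm f) n).
    by rewrite [in LHS]fE (pvmD hpvm' mBp lp lm).
  by rewrite (pvmC hpvm' mBp lp); apply/funext => n; ring.
apply: le_trans (nrmB l1 l2) _; lra.
Unshelve. all: by end_near. Qed.
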